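(* Let $f\in L^0(\mathcal U_4)$ be alternating under permutation of the four projective points. If $Df\in L^\infty(\mathcal U_5)$, then $$\|f\|_\infty\le 7\,\|Df\|_\infty .$$ If $f$ is continuous, then the sharper estimate $\|f\|_\infty\le\|Df\|_\infty$ holds.
   Context: $\mathcal U_4=\{(x,y)\in\mathbb C^2: xy(1-x+y)\ne 0\}$. $\mathcal U_5$ is the set of $(u,v,w,x,y)\in(\mathbb C^\times)^5$ such that $y-ux+vw,\ y-x+w,\ y-v+u,\ x-v+1,\ w-u+1$ are all nonzero. Both carry the Lebesgue measure class. $L^0$ denotes real-valued almost-everywhere finite measurable functions modulo equality almost everywhere, $L^\infty$ the essentially bounded ones, and $\|\cdot\|_\infty$ the essential supremum norm. (These spaces parametrize generic $4$- and $5$-tuples of lines in $\mathbb C^4$ modulo the symplectic group $\mathrm{Sp}(4,\mathbb C)$.) The operator $D:L^0(\mathcal U_4)\to L^0(\mathcal U_5)$ is $$(Df)(u,v,w,x,y)=f\!\left(\tfrac{ux}{vw},\tfrac{y}{vw}\right)-f\!\left(\tfrac xw,\tfrac yw\right)+f\!\left(\tfrac vu,\tfrac yu\right)-f(v,x)+f(u,w).$$ The group $S_4$ of permutations of the four points acts on $\mathcal U_4$ through $S_4/V_4\cong S_3$ by six maps: the even ones are $(x,y)$, $(-1/y,-x/y)$, $(y/x,-1/x)$ and the odd ones are $(1/x,-y/x)$, $(-y,-x)$, $(x/y,1/y)$. The function $f$ is alternating if $f\circ\tau=f$ for each even map $\tau$ and $f\circ\tau=-f$ for each odd map $\tau$ (almost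 everywhere for measurable classes). *)

(* Defs.v *)
From HB Require Import structures.
From mathcomp Require Import all_boot all_order all_algebra.
From mathcomp Require Import all_classical all_reals all_analysis.
From mathcomp Require Import complex.

Set Implicit Arguments.
Unset Strict Implicit.
Unset Printing Implicit Defensive.

Import Order.TTheory GRing.Theory Num.Theory.
Import numFieldNormedType.Exports.

Local Open Scope classical_set_scope.
Local Open Scope complex_scope.
Local Open Scope ring_scope.

(* The norm topology that MathComp-Analysis attaches to any [numFieldType] is
   not inferred on [R[i]] because the latter is not a structure projection. *)
HB.instance Definition _ (R : realType) :=
  NormedModule.copy R[i] (R[i] : numFieldType)^o.

Section complex_lebesgue.
Variable R : realType.
Local Notation R2 := (measurableTypeR R * measurableTypeR R)%type.

Definition pair_of_complex (z : R[i]) : R2 := let: a +i* b := z in (a, b).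

Definition complex_of_pair (p : R2) : R[i] := p.1 +i* p.2.

(* The Borel sigma-algebra of R^2, transported along (a, b) |-> a + ib. *)
HB.instance Definition _ := Measurable.copy R[i]
  (g_sigma_algebra_preimageType pair_of_complex).

Lemma measurable_complex_of_pair : measurable_fun [set: R2] complex_of_pair.
Proof.
move=> _ _ [B mB <-]; rewrite !setTI.
by rewrite (_ : _ @^-1` _ = B)//; apply/seteqP; split => -[].
Qed.

Definition lebesgueC : set R[i] -> \bar R :=
  pushforward (@lebesgue_measure R \x @lebesgue_measure R)%E complex_of_pair.

Let m2 : {measure set R2 -> \bar R} :=
  (@lebesgue_measure R \x @lebesgue_measure R)%E.

Let lebesgueC0 : lebesgueC set0 = 0%E.
Proof. exact: (measure0 m2). Qed.

Let lebesgueC_ge0 A : (0 <= lebesgueC A)%E.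
Proof. exact: (measure_ge0 m2). Qed.

Let lebesgueC_sigma_additive : semi_sigma_additive lebesgueC.
Proof.
exact: (@measure_semi_sigma_additive _ _ _
  (measure_function_pushforward__canonical__measure_function_Measure m2
     measurable_complex_of_pair)).
Qed.

HB.instance Definition _ := isMeasure.Build _ _ _ lebesgueC
  lebesgueC0 lebesgueC_ge0 lebesgueC_sigma_additive.

Let lebesgueC_sigma_finite : sigma_finite [set: R[i]] lebesgueC.
Proof.
have /sigma_finiteP[G [TG ndG Goo]] := sigma_finiteT (@lebesgue_measure R).
exists (fun n => pair_of_complex @^-1` (G n `*` G n)).
  apply/esym/seteqP; split => // -[a b] _.
  have [n _ Gna] : (\bigcup_n G n) a by rewrite -TG.
  have [k _ Gkb] : (\bigcup_n G n) b by rewrite -TG.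
  exists (maxn n k) => //; split => /=.
    by move: a Gna; exact/subsetPset/ndG/leq_maxl.
  by move: b Gkb; exact/subsetPset/ndG/leq_maxr.
move=> n; have [mGn Gn] := Goo n; split.
  by exists (G n `*` G n); rewrite ?setTI//; exact: measurableX.
rewrite /lebesgueC /pushforward -comp_preimage.
rewrite (_ : _ \o _ = id) ?preimage_id; last by apply/funext => -[].
by rewrite product_measure1E// lte_mul_pinfty// ge0_fin_numE.
Qed.

HB.instance Definition _ := Measure_isSigmaFinite.Build _ _ _ lebesgueC
  lebesgueC_sigma_finite.

End complex_lebesgue.
Arguments lebesgueC R : clear implicits.

Notation C2 R := (R[i] * R[i])%type.
Notation C5 R := (R[i] * R[i] * R[i] * R[i] * R[i])%type.

Definition lebesgueC2 (R : realType) : {measure set (C2 R) -> \bar R} :=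
  (lebesgueC R \x lebesgueC R)%E.

Definition lebesgueC5 (R : realType) : {measure set (C5 R) -> \bar R} :=
  (lebesgueC R \x lebesgueC R \x lebesgueC R \x lebesgueC R \x lebesgueC R)%E.

Definition U4 (R : realType) : set (C2 R) :=
  [set p | let: (x, y) := p in x * y * (1 - x + y) != 0].

Definition U5 (R : realType) : set (C5 R) :=
  [set p | let: (u, v, w, x, y) := p in
    [/\ [/\ u != 0, v != 0, w != 0, x != 0 & y != 0],
        y - u * x + v * w != 0,
        y - x + w != 0,
        y - v + u != 0 &
        (x - v + 1 != 0) && (w - u + 1 != 0)]].

Arguments U4 R : clear implicits.
Arguments U5 R : clear implicits.

(* On [U5 R] the five arguments of [f] lie in [U4 R]. *)
Definition Dop (R : realType) (f : C2 R -> R) (p : C5 R) : R :=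
  let: (u, v, w, x, y) := p in
  f (u * x / (v * w), y / (v * w)) - f (x / w, y / w) + f (v / u, y / u)
    - f (v, x) + f (u, w).

Definition even_maps {R : realType} : set (C2 R -> C2 R) :=
  [set (fun p => (p.1, p.2));
      (fun p => (- (1 / p.2), - (p.1 / p.2)));
      (fun p => (p.2 / p.1, - (1 / p.1)))].

Definition odd_maps {R : realType} : set (C2 R -> C2 R) :=
  [set (fun p => (1 / p.1, - (p.2 / p.1)));
      (fun p => (- p.2, - p.1));
      (fun p => (p.1 / p.2, 1 / p.2))].

(* Elements of L^0(U) are given by representatives: real functions on the
   ambient space that are (Borel) measurable on U, of which only the
   almost-everywhere class on U matters. Every class of Lebesgue measurable
   functions contains such a representative. *)
Definition L0 d (T : measurableType d) (R : realType) (U : set T) (f : T -> R)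
  := measurable_fun U f.

Definition Linf_norm d (T : measurableType d) (R : realType)
    (mu : {measure set T -> \bar R}) (U : set T) (f : T -> R) : \bar R :=
  'N[mu]_+oo [EFin \o (f \_ U)]%E.

Definition Linf d (T : measurableType d) (R : realType)
    (mu : {measure set T -> \bar R}) (U : set T) (f : T -> R) :=
  L0 U f /\ (Linf_norm mu U f < +oo)%E.

Definition alternating_S4 (R : realType) (f : C2 R -> R) :=
  (forall tau, even_maps tau -> ae_eq (lebesgueC2 R) (U4 R) (f \o tau) f) /\
  (forall tau, odd_maps tau -> ae_eq (lebesgueC2 R) (U4 R) (f \o tau) (\- f)).

(* Continuity of a class: it has a continuous representative on U. *)
Definition has_continuous_rep (R : realType) (f : C2 R -> R) :=
  exists g : C2 R -> R,
    {within U4 R, continuous g} /\ ae_eq (lebesgueC2 R) (U4 R) f g.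

(* Main.v *)
(* In the homogeneous coordinates (a, b, c) of (x, y) = (-b/a, c/a), the domain
   U_4 is a b c (a + b + c) <> 0, the group S_4 / V_4 permutes a, b, c, and
   |Df| <= M becomes, for almost all triples p and d and with M = ||Df||,
     |F(p1 d1, -p2 d2, -p3 d3) - F(p) - F(d1, d2, p3) - F(d1, -p2, d3)
        - F(p1, -d2, d3)| <= M,
   where F is alternating and homogeneous of degree 0. Consequences:
   - the sum over the permutations s of d of the inequalities at (p, s d)
     bounds F(p) minus the mean of the F(p . s d) by M, so F is locally bounded;
   - the inequalities at (p, d) and at (p, d) with two entries of p and of d
     exchanged give |F(p) - F(p1, -p2, p3)| <= 2 M;
   - for d and d' close to 1, the inequality at (q d, q d'), averaged over
     permutations, then expresses 4 F(q) through F near q^2, so that a bound K on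
     the set where the ratios |p_i / p_j|^2 are at most 256 S^2 gives the bound
     (K + 9 M) / 4 where they are at most S;
   - conversely, a triple whose ratios are at most t^2 is a product of two triples
     with ratios at most 16 t, whence the bound 3 K + M from a bound K for 16 t.
   Applying the last estimate j times and coming back by the previous one leaves
   the bound 3 M up to a term in (3/4)^j, hence |F| <= 3 M. If F is
   continuous, the inequality holds everywhere and, at (q, q d) with d -> 1, it
   gives 4 |F(q)| <= ||F|| + 3 M, hence ||F|| <= M. *)

(* Up to sign, the entries of a triple are the products of symplectic pairings along the three
   splittings of four points into two pairs; their sum is a Pfaffian, and exchanging points permutes
   them. The obstacle is that [F] is only measurable, with no bound to start from. The contraction
   controls [F] at q through values near q^2, which lie farther out, so by itself it proves nothing:
   its rate has to be compared with the rate at which bounds on [F] can grow over the same number of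
   squarings of the radius. Read naively, the inequality bounds one of its five terms by the other
   four and gives growth by a factor 4, which the contraction by 1/4 would merely balance. Using d
   together with d with two entries exchanged cancels one of these terms, and the factor drops to 3.
   Averages over permutations replace continuity: they compare F(p) with values at nearby triples p
   . d without any regularity of [F]. *)
Require Import Defs.
From HB Require Import structures.
From mathcomp Require Import all_boot all_order all_algebra.
From mathcomp Require Import all_classical all_reals all_analysis.
From mathcomp Require Import measurable_realfun ess_sup_inf complex.
From mathcomp Require Import ring lra.
Import numFieldNormedType.Exports.
Import Order.TTheory GRing.Theory Num.Theory.
Set Implicit Arguments.
Unset Strict Implicit.
Unset Printing Implicit Defensive.
Local Open Scope classical_set_scope.
Local Open Scope ring_scope.

(* The sigma-finite structure that MathComp-Analysis declares on product
   measures is shadowed by the one it infers for subprobability measures. *)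
Section product_sigma_finite.
Local Open Scope ereal_scope.
Context d1 d2 (T1 : measurableType d1) (T2 : measurableType d2) (R : realType).
Variable m1 : {sigma_finite_measure set T1 -> \bar R}.
Variable m2 : {sigma_finite_measure set T2 -> \bar R}.

Let product_measure_sigma_finite : sigma_finite setT (m1 \x m2).
Proof.
have /sigma_finiteP[F [TF ndF Foo]] := sigma_finiteT m1.
have /sigma_finiteP[G [TG ndG Goo]] := sigma_finiteT m2.
exists (fun n => F n `*` G n).
 rewrite -setXTT TF TG predeqE => -[x y]; split.
    move=> [/= [n _ Fnx] [k _ Gky]]; exists (maxn n k) => //; split.
    - by move: x Fnx; exact/subsetPset/ndF/leq_maxl.
    - by move: y Gky; exact/subsetPset/ndG/leq_maxr.
  by move=> [n _ []/= ? ?]; split; exists n.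
move=> k; have [? ?] := Foo k; have [? ?] := Goo k.
split; first exact: measurableX.
by rewrite product_measure1E// lte_mul_pinfty// ge0_fin_numE.
Qed.

Let mm : {measure set (T1 * T2)%type -> \bar R} := (m1 \x m2)%E.
Definition product_sfm : {sigma_finite_measure set (T1 * T2)%type -> \bar R} :=
  HB.pack (m1 \x m2) (Measure.class mm)
    (Measure_isSigmaFinite.Build _ _ _ mm product_measure_sigma_finite).
End product_sigma_finite.

Notation "m1 '\xs' m2" := (product_sfm m1 m2) (at level 40, left associativity).

Lemma product_sfmE d1 d2 (T1 : measurableType d1) (T2 : measurableType d2)
    (R : realType) (m1 : {sigma_finite_measure set T1 -> \bar R})
    (m2 : {sigma_finite_measure set T2 -> \bar R}) (A : set T1) (B : set T2) :
  measurable A -> measurable B -> (m1 \xs m2) (A `*` B) = (m1 A * m2 B)%E.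
Proof. exact: product_measure1E. Qed.

(** * Nonsingular maps *)

Section nonsingular_maps.
Context {R : realType}.

(** Hypotheses and conclusions concern almost every point, so null sets are all that a change of
    variables has to respect. The notion is stable under composition, and every substitution below
    is assembled from swaps, reassociations and skew maps, without Jacobian determinants. *)
Definition nonsingular d1 d2 (T1 : measurableType d1) (T2 : measurableType d2)
    (m1 : set T1 -> \bar R) (m2 : set T2 -> \bar R) (h : T1 -> T2) :=
  measurable_fun setT h /\
  forall A, measurable A -> m2 A = 0%E -> m1 (h @^-1` A) = 0%E.

Lemma nonsingular_ae d1 d2 (T1 : measurableType d1) (T2 : measurableType d2)
    (m1 : {measure set T1 -> \bar R}) (m2 : {measure set T2 -> \bar R})
    (h : T1 -> T2) (P : T2 -> Prop) :
  nonsingular m1 m2 h -> (\forall y \ae m2, P y) -> \forall x \ae m1, P (h x).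
Proof.
move=> [mh h0] [N [mN N0 PN]]; exists (h @^-1` N); split.
- by rewrite -[_ @^-1` _]setTI; exact: mh.
- exact: h0.
- by move=> x /= nP; apply: PN.
Qed.

Lemma nonsingular_id d (T : measurableType d) (m : set T -> \bar R) :
  nonsingular m m id.
Proof. by []. Qed.

Lemma nonsingular_comp d1 d2 d3 (T1 : measurableType d1)
    (T2 : measurableType d2) (T3 : measurableType d3) (m1 : set T1 -> \bar R)
    (m2 : set T2 -> \bar R) (m3 : set T3 -> \bar R) (g : T2 -> T3) (h : T1 -> T2) :
  nonsingular m2 m3 g -> nonsingular m1 m2 h -> nonsingular m1 m3 (g \o h).
Proof.
move=> [mg g0] [mh h0]; split; first exact: measurableT_comp.
move=> A mA A0; rewrite comp_preimage; apply: h0; last exact: g0.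
by rewrite -[_ @^-1` _]setTI; exact: mg.
Qed.

Section product.
Context d1 d2 (T1 : measurableType d1) (T2 : measurableType d2).
Variables (m1 : {sigma_finite_measure set T1 -> \bar R})
          (m2 : {sigma_finite_measure set T2 -> \bar R}).

(** Tonelli, and the fact that a nonnegative function has integral zero exactly when it vanishes
    almost everywhere. *)
Lemma product_null_xsection (A : set (T1 * T2)) : measurable A ->
  (m1 \xs m2) A = 0%E <-> \forall x \ae m1, m2 (xsection A x) = 0%E.
Proof.
move=> mA; have mf := measurable_fun_xsection m2 mA.
have H := ae_eq_integral_abs m1 measurableT mf.
split.
  move=> A0; have /H h : (\int[m1]_(x in setT) `|(m2 \o xsection A) x| = 0)%E.
    by rewrite -[RHS]A0; apply: eq_integral => x _; rewrite gee0_abs.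
  by apply: filterS h => x /(_ I).
move=> h; have {}h : ae_eq m1 setT (m2 \o xsection A) (cst 0%E).
  by apply: filterS h => x.
rewrite -(H.2 h) /product_measure1.
by apply: eq_integral => x _; rewrite gee0_abs.
Qed.

Lemma product_measure_swap (A : set (T1 * T2)) : measurable A ->
  (m1 \xs m2) A = (m2 \xs m1) ((fun z => (z.2, z.1)) @^-1` A).
Proof.
move=> mA.
have ms : measurable_fun setT (fun z : T2 * T1 => (z.2, z.1)) by exact: measurable_swap.
pose m' := measure_function_pushforward__canonical__measure_function_Measure
  (m2 \xs m1) ms.
suff: (m1 \xs m2) A = m' A by [].
apply: product_measure_unique => //.
move=> B C mB mC; rewrite /m' /= /pushforward.
rewrite (_ : _ @^-1` _ = C `*` B); first by rewrite product_sfmE// muleC.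
by apply/seteqP; split => -[x y] [].
Qed.

End product.

Lemma nonsingular_swap d1 d2 (T1 : measurableType d1) (T2 : measurableType d2)
    (m1 : {sigma_finite_measure set T1 -> \bar R})
    (m2 : {sigma_finite_measure set T2 -> \bar R}) :
  nonsingular (m1 \xs m2) (m2 \xs m1) (fun z => (z.2, z.1)).
Proof.
split; first exact: measurable_swap.
by move=> A mA A0; rewrite -product_measure_swap.
Qed.

Lemma ae_prod d1 d2 (T1 : measurableType d1) (T2 : measurableType d2)
    (m1 : {sigma_finite_measure set T1 -> \bar R})
    (m2 : {sigma_finite_measure set T2 -> \bar R}) (P : T1 * T2 -> Prop) :
  (\forall z \ae (m1 \xs m2), P z) ->
  \forall x \ae m1, \forall y \ae m2, P (x, y).
Proof.
move=> [N [mN /(product_null_xsection m1 m2 mN) N0 PN]].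
apply: filterS N0 => x Nx; exists (xsection N x); split => //.
  exact: measurable_xsection.
by move=> y /= nP; apply/mem_set/PN.
Qed.

(** A null set has almost all sections null, and this survives [h] on the base and [g x] on almost
    every fibre. Degenerate fibres, such as multiplication by 0, may thus be ignored. *)
Lemma nonsingular_skew d1 d2 d3 d4 (T1 : measurableType d1)
    (T2 : measurableType d2) (T3 : measurableType d3) (T4 : measurableType d4)
    (m1 : {sigma_finite_measure set T1 -> \bar R})
    (m2 : {sigma_finite_measure set T2 -> \bar R})
    (m3 : {sigma_finite_measure set T3 -> \bar R})
    (m4 : {sigma_finite_measure set T4 -> \bar R})
    (h : T1 -> T3) (g : T1 -> T2 -> T4) :
  measurable_fun setT (fun z => g z.1 z.2) ->
  nonsingular m1 m3 h -> (\forall x \ae m1, nonsingular m2 m4 (g x)) ->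
  nonsingular (m1 \xs m2) (m3 \xs m4) (fun z => (h z.1, g z.1 z.2)).
Proof.
move=> mg [mh h0] g0.
have mT : measurable_fun setT (fun z : T1 * T2 => (h z.1, g z.1 z.2)).
  apply/measurable_fun_pair => //=.
  exact: measurableT_comp.
split=> // A mA /(product_null_xsection m3 m4 mA) A0.
apply/product_null_xsection; first by rewrite -[_ @^-1` _]setTI; exact: mT.
have {}A0 := nonsingular_ae (conj mh h0 : nonsingular m1 m3 h) A0.
apply: filterS2 A0 g0 => x Ax [mgx gx0].
have := gx0 _ (measurable_xsection _ mA) Ax; apply: etrans; congr (m2 _).
Qed.

Lemma nonsingular_pair d1 d2 d3 d4 (T1 : measurableType d1)
    (T2 : measurableType d2) (T3 : measurableType d3) (T4 : measurableType d4)
    (m1 : {sigma_finite_measure set T1 -> \bar R})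
    (m2 : {sigma_finite_measure set T2 -> \bar R})
    (m3 : {sigma_finite_measure set T3 -> \bar R})
    (m4 : {sigma_finite_measure set T4 -> \bar R})
    (h : T1 -> T3) (g : T2 -> T4) :
  nonsingular m1 m3 h -> nonsingular m2 m4 g ->
  nonsingular (m1 \xs m2) (m3 \xs m4) (fun z => (h z.1, g z.2)).
Proof.
move=> nh ng; apply: (@nonsingular_skew _ _ _ _ _ _ _ _ m1 m2 m3 m4 h (fun=> g)) => //.
  by apply: measurableT_comp => //; case: ng.
exact: aeW.
Qed.

Lemma nonsingular_fst d1 d2 (T1 : measurableType d1) (T2 : measurableType d2)
    (m1 : {sigma_finite_measure set T1 -> \bar R})
    (m2 : {sigma_finite_measure set T2 -> \bar R}) :
  nonsingular (m1 \xs m2) m1 fst.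
Proof.
split=> // A mA A0; rewrite (_ : _ @^-1` _ = A `*` setT).
  rewrite product_sfmE//.
  transitivity (0 * m2 setT)%E; last by rewrite mul0e.
  by congr (_ * _)%E; exact: A0.
by apply/seteqP; split => -[x y] // [].
Qed.

Lemma nonsingular_snd d1 d2 (T1 : measurableType d1) (T2 : measurableType d2)
    (m1 : {sigma_finite_measure set T1 -> \bar R})
    (m2 : {sigma_finite_measure set T2 -> \bar R}) :
  nonsingular (m1 \xs m2) m2 snd.
Proof.
exact: (nonsingular_comp (nonsingular_fst m2 m1) (nonsingular_swap m1 m2)).
Qed.

Lemma nonsingular_assoc d1 d2 d3 (T1 : measurableType d1)
    (T2 : measurableType d2) (T3 : measurableType d3)
    (m1 : {sigma_finite_measure set T1 -> \bar R})
    (m2 : {sigma_finite_measure set T2 -> \bar R})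
    (m3 : {sigma_finite_measure set T3 -> \bar R}) :
  nonsingular (m1 \xs m2 \xs m3) (m1 \xs (m2 \xs m3))
    (fun z => (z.1.1, (z.1.2, z.2))).
Proof.
have mT : measurable_fun setT
    (fun z : T1 * T2 * T3 => (z.1.1, (z.1.2, z.2))).
  apply/measurable_fun_pair => //=; first exact: measurableT_comp.
  by apply/measurable_fun_pair => //=; exact: measurableT_comp.
split=> // A mA /(@product_null_xsection _ _ T1 (T2 * T3)%type m1 (m2 \xs m3) A mA) A0.
have mA' : measurable [set z : T1 * T2 * T3 | A (z.1.1, (z.1.2, z.2))].
  by rewrite -[X in measurable X]setTI; exact: (mT measurableT).
apply/(@product_null_xsection _ _ (T1 * T2)%type T3 (m1 \xs m2) m3) => //.
set A' := (X in measurable X) in mA'.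
(* Measurability of the set of pairs with a null section is what allows Tonelli to be applied a
   second time, to that set. *)
have : measurable ((m3 \o xsection A') @^-1` [set 0%E]).
  by rewrite -[X in measurable X]setTI; exact: measurable_fun_xsection.
move=> /measurableC mB; apply/(negligibleP _ mB).
apply/(product_null_xsection m1 m2) => //.
apply: filterS A0 => x.
move/(product_null_xsection m2 m3 (measurable_xsection x mA)).
move=> h; apply/(negligibleP _ (measurable_xsection x mB)).
apply: negligibleS h => y; rewrite /xsection /= inE /=; apply: contra_not.
apply: etrans; congr (m3 _).
by apply/seteqP; split => z /=; rewrite /xsection /= !inE /= ?inE.
Qed.

Lemma nonsingular_assocV d1 d2 d3 (T1 : measurableType d1)
    (T2 : measurableType d2) (T3 : measurableType d3)
    (m1 : {sigma_finite_measure set T1 -> \bar R})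
    (m2 : {sigma_finite_measure set T2 -> \bar R})
    (m3 : {sigma_finite_measure set T3 -> \bar R}) :
  nonsingular (m1 \xs (m2 \xs m3)) (m1 \xs m2 \xs m3)
    (fun z => ((z.1, z.2.1), z.2.2)).
Proof.
have mT : measurable_fun setT
    (fun z : T1 * (T2 * T3) => ((z.1, z.2.1), z.2.2)).
  apply/measurable_fun_pair => /=; last exact: measurableT_comp.
  by apply/measurable_fun_pair => //=; exact: measurableT_comp.
split=> // A mA /(@product_null_xsection _ _ (T1 * T2)%type T3 (m1 \xs m2) m3 A mA) /ae_prod A0.
have mA' : measurable [set z : T1 * (T2 * T3) | A ((z.1, z.2.1), z.2.2)].
  by rewrite -[X in measurable X]setTI; exact: (mT measurableT).
apply/(@product_null_xsection _ _ T1 (T2 * T3)%type m1 (m2 \xs m3)) => //.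
apply: filterS A0 => x Ax.
apply/(product_null_xsection m2 m3); first exact: measurable_xsection.
apply: filterS Ax => y; apply: etrans; congr (m3 _).
by apply/seteqP; split => z /=; rewrite /xsection /= !inE /= inE.
Qed.

End nonsingular_maps.

(** * Measurability and scaling in the complex plane *)

Section complex_measurable.
Context {R : realType}.
Local Notation TR := (measurableTypeR R).

Lemma measurable_pair_of_complex : measurable_fun setT (@pair_of_complex R).
Proof. by move=> _ A mA; exists A. Qed.

Lemma measurable_Re : measurable_fun setT (@complex.Re R : R[i] -> TR).
Proof.
have -> : @complex.Re R = fst \o @pair_of_complex R by apply/funext => -[].
exact: measurableT_comp measurable_fst measurable_pair_of_complex.
Qed.

Lemma measurable_Im : measurable_fun setT (@complex.Im R : R[i] -> TR).
Proof.
have -> : @complex.Im R = snd \o @pair_of_complex R by apply/funext => -[].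
exact: measurableT_comp measurable_snd measurable_pair_of_complex.
Qed.

Section functions.
Context d (T : measurableType d).
Implicit Types f g : T -> R[i].

Lemma measurable_fun_complex f :
  measurable_fun setT (fun x => complex.Re (f x) : TR) ->
  measurable_fun setT (fun x => complex.Im (f x) : TR) ->
  measurable_fun setT f.
Proof.
move=> mRe mIm.
have -> : f = @complex_of_pair R \o (fun x => (complex.Re (f x), complex.Im (f x))).
  by apply/funext => x /=; rewrite /complex_of_pair; case: (f x).
apply: measurableT_comp; first exact: measurable_complex_of_pair.
exact/measurable_fun_pair.
Qed.

Lemma measurable_fun_Re f : measurable_fun setT f ->
  measurable_fun setT (fun x => complex.Re (f x) : TR).
Proof. exact: measurableT_comp measurable_Re. Qed.

Lemma measurable_fun_Im f : measurable_fun setT f ->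
  measurable_fun setT (fun x => complex.Im (f x) : TR).
Proof. exact: measurableT_comp measurable_Im. Qed.

Lemma measurable_funC_N f : measurable_fun setT f ->
  measurable_fun setT (fun x => - f x).
Proof.
move=> mf; apply: measurable_fun_complex.
  under eq_fun do rewrite raddfN /=.
  by apply: measurableT_comp => //; exact: measurable_fun_Re.
under eq_fun do rewrite raddfN /=.
by apply: measurableT_comp => //; exact: measurable_fun_Im.
Qed.

Lemma measurable_funC_D f g : measurable_fun setT f -> measurable_fun setT g ->
  measurable_fun setT (fun x => f x + g x).
Proof.
move=> mf mg; apply: measurable_fun_complex.
  under eq_fun do rewrite raddfD /=.
  by apply: measurable_funD; exact: measurable_fun_Re.
under eq_fun do rewrite raddfD /=.
by apply: measurable_funD; exact: measurable_fun_Im.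
Qed.

Lemma measurable_funC_M f g : measurable_fun setT f -> measurable_fun setT g ->
  measurable_fun setT (fun x => f x * g x).
Proof.
move=> mf mg.
have [[? ?] [? ?]] := (conj (conj (measurable_fun_Re mf) (measurable_fun_Im mf))
  (conj (measurable_fun_Re mg) (measurable_fun_Im mg))).
apply: measurable_fun_complex.
  rewrite (_ : (fun x => _) = (fun x => complex.Re (f x) * complex.Re (g x)
    - complex.Im (f x) * complex.Im (g x))).
    by apply: measurable_funB; apply: measurable_funM.
  by apply/funext => x; case: (f x) (g x) => ? ? [? ?].
rewrite (_ : (fun x => _) = (fun x => complex.Re (f x) * complex.Im (g x)
    + complex.Im (f x) * complex.Re (g x))).
  by apply: measurable_funD; apply: measurable_funM.
by apply/funext => x; case: (f x) (g x) => ? ? [? ?].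
Qed.

Lemma measurable_funC_V f : measurable_fun setT f ->
  measurable_fun setT (fun x => (f x)^-1).
Proof.
move=> mf.
have [mRe mIm] := (conj (measurable_fun_Re mf) (measurable_fun_Im mf)).
pose n x := (complex.Re (f x) ^+ 2 + complex.Im (f x) ^+ 2)^-1.
have mn : measurable_fun setT (n : T -> TR).
  have -> : n = (@powR R)^~ (-1) \o
      (fun x => complex.Re (f x) ^+ 2 + complex.Im (f x) ^+ 2).
    by apply/funext => x /=; rewrite powR_inv1// addr_ge0// sqr_ge0.
  apply: measurableT_comp; first exact: measurable_powR.
  by apply: measurable_funD; exact: measurable_funX.
apply: measurable_fun_complex.
  rewrite (_ : (fun x => _) = (fun x => complex.Re (f x) * n x)).
    exact: measurable_funM.
  by apply/funext => x; rewrite /n; case: (f x).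
rewrite (_ : (fun x => _) = (fun x => - (complex.Im (f x) * n x))).
  by apply: measurableT_comp => //; exact: measurable_funM.
by apply/funext => x; rewrite /n; case: (f x) => a b /=; rewrite ?mulNr.
Qed.

End functions.

Lemma measurable_mulCl (k : R[i]) : measurable_fun setT ( *%R k).
Proof. by apply: (@measurable_funC_M _ _ (cst k) id). Qed.
End complex_measurable.

Section complex_scaling.
Local Open Scope complex_scope.
Context {R : realType}.
Local Notation TR := (measurableTypeR R).
Local Notation R2 := (TR * TR)%type.
Local Notation lambda := (@lebesgue_measure R).

Lemma lebesgue_measure_affine (a b : R) (A : set TR) : a != 0 -> measurable A ->
  lambda ((fun x : TR => a * x + b : TR) @^-1` A) = (`|a^-1|%:E * lambda A)%E.
Proof.
move=> a0 mA.
have mf : measurable_fun setT (fun x : TR => a * x + b : TR).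
  by apply: measurable_funD => //; apply: measurable_funM.
pose nu := measure_function_pushforward__canonical__measure_function_Measure
  lambda mf.
have na0 : 0 <= `|a| by [].
pose m' := mscale (NngNum na0) nu.
suff : lambda A = m' A.
  move=> ->; rewrite /m' /mscale /= muleA -EFinM normfV mulVf ?normr_eq0//.
  by rewrite mul1e.
apply: lebesgue_measure_unique => //= _ [[s t]] _ <-.
rewrite /m' /mscale /= /pushforward lebesgue_measure_itv /= lte_fin.
have [a_gt0|a_lt0|/eqP] := ltgtP 0 a; last by rewrite eq_sym (negbTE a0).
- rewrite [X in lambda X](_ : _ = `]((s - b) / a), ((t - b) / a)]%classic).
    rewrite lebesgue_measure_itv /= lte_fin ltr_pM2r ?invr_gt0// ltrD2r.
    case: ifPn => _; last by rewrite mule0.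
    rewrite gtr0_norm// -!EFinB -EFinM; congr EFin; field; lra.
  by apply/seteqP; split => x /=;
    rewrite !in_itv /= ltr_pdivrMr// ler_pdivlMr// ltrBlDr lerBrDr (mulrC x).
- rewrite [X in lambda X](_ : _ = `[((t - b) / a), ((s - b) / a)[%classic).
    rewrite lebesgue_measure_itv /= lte_fin ltr_nM2r ?invr_lt0// ltrD2r.
    case: ifPn => _; last by rewrite mule0.
    rewrite ltr0_norm// -!EFinB -EFinM; congr EFin; field; lra.
  by apply/seteqP; split => x /=; rewrite !in_itv /= ler_ndivrMr//
    ltr_ndivlMr// ltrBlDr lerBrDr (mulrC x) andbC.
Qed.

Local Notation lambda2 := (lambda \xs lambda).

Lemma product_lebesgue_shear (a : R) (b : TR -> R) (A : set R2) :
  a != 0 -> measurable_fun setT b -> measurable A ->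
  lambda2 ((fun z : R2 => (z.1, a * z.2 + b z.1 : TR)) @^-1` A)
    = (`|a^-1|%:E * lambda2 A)%E.
Proof.
move=> a0 mb mA.
have -> : (lambda2 A = \int[lambda]_x lambda (xsection A x))%E by [].
rewrite -ge0_integralZl_EFin//; last exact: measurable_fun_xsection.
set B := _ @^-1` _.
have -> : (lambda2 B = \int[lambda]_x lambda (xsection B x))%E by [].
apply: eq_integral => x _.
rewrite -(lebesgue_measure_affine (b x))//; last exact: measurable_xsection.
Qed.

Lemma product_lebesgue_shear_swap (a : R) (b : TR -> R) (A : set R2) :
  a != 0 -> measurable_fun setT b -> measurable A ->
  lambda2 ((fun z : R2 => (a * z.1 + b z.2 : TR, z.2)) @^-1` A)
    = (`|a^-1|%:E * lambda2 A)%E.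
Proof.
move=> a0 mb mA.
have ms : measurable ((fun z : R2 => (z.2, z.1)) @^-1` A).
  by rewrite -[X in measurable X]setTI; exact: measurable_swap.
rewrite [in RHS]product_measure_swap// -(product_lebesgue_shear a0 mb)//.
rewrite [LHS]product_measure_swap//.
have mT : measurable_fun setT (fun z : R2 => (a * z.1 + b z.2 : TR, z.2)).
  apply/measurable_fun_pair => //=; apply: measurable_funD.
    by apply: measurable_funM.
  by apply: measurableT_comp.
by rewrite -[X in measurable X]setTI; exact: mT.
Qed.

Local Notation sqnorm k := (complex.Re k ^+ 2 + complex.Im k ^+ 2).

(** As a real matrix, multiplication by k1 + i k2 is [S2] after [S1], two shears with diagonal
    entries k1 and (k1^2 + k2^2) / k1; the factorization requires k1 to be nonzero. *)
Let lebesgueC_mul_Re (k : R[i]) (A : set R[i]) :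
  complex.Re k != 0 -> measurable A ->
  lebesgueC R (( *%R k) @^-1` A) = ((sqnorm k)^-1%:E * lebesgueC R A)%E.
Proof.
case: k => k1 k2 /= k10 mA.
have mP : measurable ((@complex_of_pair R) @^-1` A).
  by rewrite -[X in measurable X]setTI; exact: measurable_complex_of_pair.
have K0 : 0 < k1 ^+ 2 + k2 ^+ 2.
  by rewrite ltr_pwDl ?sqr_ge0// exprn_even_gt0.
pose S2 (z : R2) : R2 :=
  (z.1, (k1 ^+ 2 + k2 ^+ 2) / k1 * z.2 + (k2 / k1) * z.1).
pose S1 (z : R2) : R2 := (k1 * z.1 + (- k2) * z.2, z.2).
have mS2 : measurable_fun setT S2.
  apply/measurable_fun_pair => //=; apply: measurable_funD;
  by apply: measurable_funM.
transitivity (lambda2 (S1 @^-1` (S2 @^-1` (@complex_of_pair R @^-1` A)))).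
  congr (lambda2 _); apply/seteqP.
  suff E z : k1 +i* k2 * complex_of_pair z = complex_of_pair (S2 (S1 z)).
    by split => z; rewrite /= E.
  case: z => x y; rewrite /complex_of_pair /S1 /S2 /=; simpc.
  by congr (_ +i* _); field.
rewrite [LHS]product_lebesgue_shear_swap//; last first.
- by rewrite -[X in measurable X]setTI; exact: mS2.
rewrite [X in (_ * X)%E]product_lebesgue_shear//; last first.
  by rewrite mulf_neq0 ?invr_eq0// gt_eqF.
rewrite muleA -EFinM; congr (_%:E * _)%E.
have E : k1^-1 * ((k1 ^+ 2 + k2 ^+ 2) / k1)^-1 = (k1 ^+ 2 + k2 ^+ 2)^-1.
  by field; rewrite k10 gt_eqF.
by rewrite -normrM E gtr0_norm// invr_gt0.
Qed.

Lemma lebesgueC_mul (k : R[i]) (A : set R[i]) : k != 0 -> measurable A ->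
  lebesgueC R (( *%R k) @^-1` A) = ((sqnorm k)^-1%:E * lebesgueC R A)%E.
Proof.
move=> k0 mA; have [k10|] := eqVneq (complex.Re k) 0; last first.
  by move/lebesgueC_mul_Re; apply.
case: k k0 k10 => k1 k2 k0 /= k1E; subst k1.
move: k0; rewrite eq_complex /= eqxx /= => k20.
(* A purely imaginary number is a product of two numbers with nonzero real part, to which the
   previous case applies. *)
have ki : 0 +i* k2 = (1 +i* 1) * (k2 / 2 +i* (k2 / 2)) :> R[i].
  by simpc; congr (_ +i* _); lra.
have E : *%R (0 +i* k2) = *%R (1 +i* 1) \o *%R (k2 / 2 +i* (k2 / 2)).
  by apply/funext => z; rewrite ki /= mulrA.
have mB : measurable ( *%R (1 +i* 1) @^-1` A).
  rewrite -[X in measurable X]setTI.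
  exact: measurable_mulCl.
have h1 : complex.Re (1 +i* 1 : R[i]) != 0 by rewrite /= oner_eq0.
have h2 : complex.Re (k2 / 2 +i* (k2 / 2)) != 0.
  by rewrite /= mulf_neq0// invr_eq0 pnatr_eq0.
rewrite E comp_preimage (lebesgueC_mul_Re h2 mB) (lebesgueC_mul_Re h1 mA).
rewrite muleA -EFinM; congr (_%:E * _)%E => /=.
by field; rewrite k20 -mulr2n mulrn_eq0 sqrf_eq0.
Qed.
End complex_scaling.

Section scaling_maps.
Context {R : realType}.

(** Nonsingularity with an exact factor; the factor itself enters the estimate of exceptional sets
    in [locally_bounded]. *)
Definition scales d (T : measurableType d) (m : set T -> \bar R) (h : T -> T)
    (c : R) := measurable_fun setT h /\
  forall A, measurable A -> m (h @^-1` A) = (c%:E * m A)%E.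

Lemma scales_nonsingular d (T : measurableType d) (m : set T -> \bar R)
    (h : T -> T) (c : R) : scales m h c -> nonsingular m m h.
Proof. by move=> [mh hc]; split=> // A mA A0; rewrite hc// A0 mule0. Qed.

Lemma scales_pair d1 d2 (T1 : measurableType d1) (T2 : measurableType d2)
    (m1 : {sigma_finite_measure set T1 -> \bar R})
    (m2 : {sigma_finite_measure set T2 -> \bar R}) (h1 : T1 -> T1)
    (h2 : T2 -> T2) (c1 c2 : R) : 0 < c1 -> 0 < c2 ->
  scales m1 h1 c1 -> scales m2 h2 c2 ->
  scales (m1 \xs m2) (fun z => (h1 z.1, h2 z.2)) (c1 * c2).
Proof.
move=> c1_gt0 c2_gt0 [mh1 s1] [mh2 s2].
have mh : measurable_fun setT (fun z : T1 * T2 => (h1 z.1, h2 z.2)).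
  by apply/measurable_fun_pair => //=; exact: measurableT_comp.
split=> // A mA.
pose nu := measure_function_pushforward__canonical__measure_function_Measure
  (m1 \xs m2) mh.
have c_gt0 : 0 < c1 * c2 by rewrite mulr_gt0.
have ci_ge0 : 0 <= (c1 * c2)^-1 by rewrite invr_ge0 ltW.
pose m' := mscale (NngNum ci_ge0) nu.
have E : (m1 \xs m2) A = m' A.
  apply: product_measure_unique => // B C mB mC.
  change (((c1 * c2)^-1)%R%:E *
    (m1 \xs m2) ((h1 @^-1` B) `*` (h2 @^-1` C)) = m1 B * m2 C)%E.
  rewrite product_sfmE; last 2 first.
  - by rewrite -[X in measurable X]setTI; exact: mh1.
  - by rewrite -[X in measurable X]setTI; exact: mh2.
  rewrite s1// s2// muleACA -EFinM [LHS]muleA -EFinM mulVf ?mul1e//.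
  by rewrite gt_eqF.
rewrite E /m' /mscale /= /pushforward muleA -EFinM mulfV ?mul1e//.
by rewrite gt_eqF.
Qed.

(* The norm of [R[i]] takes its values in [R[i]]. *)
Definition sqnorm (k : R[i]) := complex.Re k ^+ 2 + complex.Im k ^+ 2.

Lemma sqnorm_gt0 (k : R[i]) : k != 0 -> 0 < sqnorm k.
Proof.
case: k => a b; rewrite eq_complex negb_and /sqnorm /=.
by case/orP => h; [rewrite ltr_pwDl|rewrite ltr_wpDl];
  rewrite ?sqr_ge0// exprn_even_gt0.
Qed.

Lemma scales_mulC (k : R[i]) : k != 0 ->
  scales (lebesgueC R) ( *%R k) (sqnorm k)^-1.
Proof.
by move=> k0; split; [exact: measurable_mulCl|move=> A; exact: lebesgueC_mul].
Qed.

Lemma lebesgueC_rect (A B : set (measurableTypeR R)) :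
  measurable A -> measurable B ->
  lebesgueC R [set z | A (complex.Re z) /\ B (complex.Im z)] =
  (lebesgue_measure A * lebesgue_measure B)%E.
Proof. exact: (@product_sfmE _ _ _ _ _ lebesgue_measure lebesgue_measure). Qed.

Lemma measurable_rectC (A B : set (measurableTypeR R)) :
  measurable A -> measurable B ->
  measurable [set z : R[i] | A (complex.Re z) /\ B (complex.Im z)].
Proof.
move=> mA mB; apply: measurableI.
  by rewrite -[X in measurable X]setTI; exact: measurable_Re.
by rewrite -[X in measurable X]setTI; exact: measurable_Im.
Qed.

Lemma measurable_set1C (a : R[i]) : measurable [set a].
Proof.
rewrite (_ : [set a] =
  [set z | [set complex.Re a] (complex.Re z) /\ [set complex.Im a] (complex.Im z)]).
  exact: measurable_rectC.
by apply/seteqP; split => -[x y]; case: a => a b /= [] -> ->.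
Qed.

Lemma lebesgueC_set1 (a : R[i]) : lebesgueC R [set a] = 0%E.
Proof.
rewrite (_ : [set a] =
  [set z | [set complex.Re a] (complex.Re z) /\ [set complex.Im a] (complex.Im z)]).
  by rewrite lebesgueC_rect// lebesgue_measure_set1 mul0e.
by apply/seteqP; split => -[x y]; case: a => a b /= [] -> ->.
Qed.

End scaling_maps.

(** The device that turns almost-everywhere inequalities into inequalities at one point: finitely
    many of them hold together somewhere in any set of positive measure. *)
Lemma ae_exists d (T : measurableType d) (R : realType)
    (m : {measure set T -> \bar R}) (W : set T) (P : T -> Prop) :
  measurable W -> (0 < m W)%E -> (\forall x \ae m, P x) -> exists2 x, W x & P x.
Proof.
move=> mW W_gt0 [N [mN N0 PN]]; apply: contrapT => nex.
have : W `<=` N.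
  by move=> x Wx; apply: PN => /= Px; apply: nex; exists x.
move=> WN; have : (m W <= m N)%E by apply: le_measure; rewrite ?inE.
by apply/negP; rewrite -ltNge (_ : m N = 0%E).
Qed.

(** * Lebesgue measure on triples of complex numbers *)

Section triples.
Context {R : realType}.
Local Notation C := R[i].
Local Notation V := (C * C * C)%type.
Local Notation mu1 := (lebesgueC R).

Definition muV : {sigma_finite_measure set V -> \bar R} := mu1 \xs mu1 \xs mu1.
Definition muC2 : {sigma_finite_measure set (C * C)%type -> \bar R} := mu1 \xs mu1.

Section measurability.
Context d (T : measurableType d).
Implicit Types f g : T -> V.

Lemma measurable_fun_triple f :
  measurable_fun setT (fun x => (f x).1.1) ->
  measurable_fun setT (fun x => (f x).1.2) ->
  measurable_fun setT (fun x => (f x).2) -> measurable_fun setT f.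
Proof.
move=> m1 m2 m3.
rewrite (_ : f = fun x => ((f x).1.1, (f x).1.2, (f x).2)); last first.
  by apply/funext => x; case: (f x) => -[].
by apply/measurable_fun_pair => //; exact/measurable_fun_pair.
Qed.

Lemma measurable_fun_11 f : measurable_fun setT f ->
  measurable_fun setT (fun x => (f x).1.1).
Proof.
move=> mf; apply: (measurableT_comp (f := fst)) => //.
exact: (measurableT_comp (f := fst)).
Qed.

Lemma measurable_fun_12 f : measurable_fun setT f ->
  measurable_fun setT (fun x => (f x).1.2).
Proof.
move=> mf; apply: (measurableT_comp (f := snd)) => //.
exact: (measurableT_comp (f := fst)).
Qed.

Lemma measurable_fun_2 f : measurable_fun setT f ->
  measurable_fun setT (fun x => (f x).2).
Proof. exact: (measurableT_comp (f := snd)). Qed.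

Lemma measurable_mulV f g : measurable_fun setT f -> measurable_fun setT g ->
  measurable_fun setT (fun x => f x * g x).
Proof.
move=> mf mg; apply: measurable_fun_triple => /=; apply: measurable_funC_M;
  by [exact: measurable_fun_11|exact: measurable_fun_12|exact: measurable_fun_2].
Qed.

End measurability.

Lemma unit_tripleE (p : V) :
  (p \is a GRing.unit) = [&& p.1.1 != 0, p.1.2 != 0 & p.2 != 0].
Proof. by case: p => -[a b] c; rewrite !unfold_in /= !unitfE andbA. Qed.

Definition scaleV (k : V) : R :=
  (sqnorm k.1.1)^-1 * (sqnorm k.1.2)^-1 * (sqnorm k.2)^-1.

Lemma scales_mulV (k : V) : k \is a GRing.unit -> scales muV ( *%R k) (scaleV k).
Proof.
rewrite unit_tripleE => /and3P[k1 k2 k3].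
have pos (z : C) : z != 0 -> 0 < (sqnorm z)^-1.
  by move=> z0; rewrite invr_gt0 sqnorm_gt0.
have h12 := scales_pair (pos _ k1) (pos _ k2) (scales_mulC k1) (scales_mulC k2).
have h := scales_pair (mulr_gt0 (pos _ k1) (pos _ k2)) (pos _ k3) h12 (scales_mulC k3).
by move: h; congr scales; apply/funext => -[[a b] c].
Qed.

Lemma nonsingular_mulV (k : V) : k \is a GRing.unit -> nonsingular muV muV ( *%R k).
Proof. by move/scales_mulV/scales_nonsingular. Qed.

Lemma ae_neq0 (a : C) : \forall z \ae mu1, z != a.
Proof.
apply: (@negligibleS _ _ _ _ [set a]) => [z /= /negP/negPn/eqP//|].
by apply/negligibleP; [exact: measurable_set1C|exact: lebesgueC_set1].
Qed.

Lemma ae_unit : \forall p \ae muV, p \is a GRing.unit.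
Proof.
have n1 : nonsingular muV mu1 (fun p => p.1.1).
  exact: (nonsingular_comp (nonsingular_fst _ _) (nonsingular_fst _ _)).
have n2 : nonsingular muV mu1 (fun p => p.1.2).
  exact: (nonsingular_comp (nonsingular_snd _ _) (nonsingular_fst _ _)).
have n3 : nonsingular muV mu1 (fun p => p.2) by exact: nonsingular_snd.
have h1 := nonsingular_ae n1 (ae_neq0 0).
have h2 := nonsingular_ae n2 (ae_neq0 0).
have h3 := nonsingular_ae n3 (ae_neq0 0).
by apply: filterS3 h1 h2 h3 => p p1 p2 p3; rewrite unit_tripleE p1 p2.
Qed.

Definition swap12 (p : V) : V := (p.1.2, p.1.1, p.2).
Definition swap23 (p : V) : V := (p.1.1, p.2, p.1.2).
Definition swap13 (p : V) : V := (p.2, p.1.2, p.1.1).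
Definition rot1 (p : V) : V := (p.1.2, p.2, p.1.1).
Definition rot2 (p : V) : V := (p.2, p.1.1, p.1.2).

Lemma nonsingular_swap12 : nonsingular muV muV swap12.
Proof. exact: (nonsingular_pair (nonsingular_swap _ _) (nonsingular_id _)). Qed.

Lemma nonsingular_swap23 : nonsingular muV muV swap23.
Proof.
have h := nonsingular_pair (nonsingular_id mu1) (nonsingular_swap mu1 mu1).
exact: (nonsingular_comp (nonsingular_assocV _ _ _)
  (nonsingular_comp h (nonsingular_assoc _ _ _))).
Qed.

Lemma nonsingular_rot1 : nonsingular muV muV rot1.
Proof. exact: (nonsingular_comp nonsingular_swap23 nonsingular_swap12). Qed.

Lemma nonsingular_rot2 : nonsingular muV muV rot2.
Proof. exact: (nonsingular_comp nonsingular_swap12 nonsingular_swap23). Qed.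

Lemma nonsingular_swap13 : nonsingular muV muV swap13.
Proof. exact: (nonsingular_comp nonsingular_rot2 nonsingular_swap12). Qed.

Definition mix12 (z : V * V) : V := (z.2.1, z.1.2).
Definition mix13 (z : V * V) : V := (z.2.1.1, z.1.1.2, z.2.2).
Definition mix23 (z : V * V) : V := (z.1.1.1, z.2.1.2, z.2.2).

Lemma nonsingular_mix12 : nonsingular (muV \xs muV) muV mix12.
Proof.
have h := nonsingular_pair (nonsingular_fst muC2 mu1) (nonsingular_snd muC2 mu1).
exact: (nonsingular_comp h (nonsingular_swap muV muV)).
Qed.

Lemma nonsingular_mix13 : nonsingular (muV \xs muV) muV mix13.
Proof.
have h := nonsingular_pair nonsingular_swap23 nonsingular_swap23.
exact: (nonsingular_comp nonsingular_swap23 (nonsingular_comp nonsingular_mix12 h)).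
Qed.

Lemma nonsingular_mix23 : nonsingular (muV \xs muV) muV mix23.
Proof.
have h := nonsingular_pair nonsingular_swap13 nonsingular_swap13.
exact: (nonsingular_comp nonsingular_swap13 (nonsingular_comp nonsingular_mix12 h)).
Qed.

Lemma nonsingular_skewV (h : V -> V) :
  measurable_fun setT h -> (\forall p \ae muV, h p \is a GRing.unit) ->
  nonsingular (muV \xs muV) (muV \xs muV) (fun z => (z.1, h z.1 * z.2)).
Proof.
move=> mh h_unit.
apply: (@nonsingular_skew _ _ _ _ _ _ _ _ _ muV muV muV muV id (fun p => *%R (h p))).
- apply: measurable_mulV => //; apply: measurableT_comp => //.
- exact: nonsingular_id.
- by apply: filterS h_unit => p; exact: nonsingular_mulV.
Qed.

Lemma nonsingular_mulVV : nonsingular (muV \xs muV) muV (fun z => z.1 * z.2).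
Proof.
have h := @nonsingular_skewV id (@measurable_id _ _ _) ae_unit.
exact: (nonsingular_comp (nonsingular_snd _ _) h).
Qed.

Definition affine_coords (p : V) : C * C := (- (p.1.2 / p.1.1), p.2 / p.1.1).

Lemma nonsingular_affine_coords : nonsingular muV muC2 affine_coords.
Proof.
pose g (a : C) (z : C * C) := (- a^-1 * z.1, a^-1 * z.2).
have mg : measurable_fun setT (fun z : C * (C * C) => g z.1 z.2).
  have m1 : measurable_fun setT (fun z : C * (C * C) => z.1^-1).
    exact: measurable_funC_V.
  apply/measurable_fun_pair => /=; apply: measurable_funC_M => //.
  - exact: measurable_funC_N.
  - exact: measurableT_comp.
  - exact: measurableT_comp.
have h : nonsingular (mu1 \xs muC2) (mu1 \xs muC2) (fun z => (z.1, g z.1 z.2)).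
  apply: (@nonsingular_skew _ _ _ _ _ _ _ _ _ mu1 muC2 mu1 muC2 id g) => //.
  apply: filterS (ae_neq0 0) => a a0.
  apply: (@nonsingular_pair _ _ _ _ _ _ _ _ _ mu1 mu1 mu1 mu1);
    by apply/scales_nonsingular/scales_mulC; rewrite ?oppr_eq0 invr_eq0.
have := nonsingular_comp (nonsingular_snd _ _) (nonsingular_comp h (nonsingular_assoc mu1 mu1 mu1)).
congr nonsingular; apply/funext => -[[a b] c]; rewrite /affine_coords /g /=.
by rewrite mulNr mulrC [c / a]mulrC.
Qed.

(** The slice with first entry 1 is itself null, so Fubini says nothing about it directly. It does
    provide some nonzero first entry [a] whose slice is good, and homogeneity moves that slice to
    1. *)
Lemma ae_affine (P : V -> Prop) :
  (forall (k : C) p, k != 0 -> P (k * p.1.1, k * p.1.2, k * p.2) -> P p) ->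
  (\forall p \ae muV, P p) -> \forall z \ae muC2, P (1, - z.1, z.2).
Proof.
move=> Phom /(nonsingular_ae (nonsingular_assocV mu1 mu1 mu1)) /ae_prod P1.
have C_gt0 : (0 < mu1 setT)%E.
  rewrite (_ : setT = [set z : C | setT (complex.Re z) /\ setT (complex.Im z)]).
    rewrite lebesgueC_rect// -set_itvNyy lebesgue_measure_itv/=.
    by rewrite mulyy lt0y.
  by apply/seteqP; split.
have [a _ [a0 Pa]] := ae_exists measurableT C_gt0 (filterI (ae_neq0 0) P1).
have hk : nonsingular muC2 muC2 (fun z => (- a * z.1, a * z.2)).
  apply: (@nonsingular_pair _ _ _ _ _ _ _ _ _ mu1 mu1 mu1 mu1);
    by apply/scales_nonsingular/scales_mulC; rewrite ?oppr_eq0.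
apply: filterS (nonsingular_ae hk Pa) => -[y z] /= h.
by apply: (Phom a) => //=; rewrite mulr1 mulrN -mulNr.
Qed.

Definition near1 (r : R) : set C :=
  [set z | `]1 - r, 1 + r[%classic (complex.Re z) /\ `]- r, r[%classic (complex.Im z)].

(** A cube rather than a ball: it is stable under permutation of the entries and its measure is
    explicit, equal to 1 for r = 1/2. *)
Definition window (r : R) : set V := near1 r `*` near1 r `*` near1 r.

Lemma measurable_near1 r : measurable (near1 r).
Proof. exact: measurable_rectC. Qed.

Lemma measurable_window r : measurable (window r).
Proof.
by apply: measurableX; [apply: measurableX|]; exact: measurable_near1.
Qed.

Lemma lebesgueC_near1 r : 0 < r -> mu1 (near1 r) = ((2 * r) ^+ 2)%:E.
Proof.
move=> r0; rewrite lebesgueC_rect//.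
rewrite !lebesgue_measure_itv/= !lte_fin ltrD2l (_ : - r < r); last by lra.
by rewrite -!EFinB -EFinM; congr EFin; ring.
Qed.

Lemma muV_window r : 0 < r -> muV (window r) = ((2 * r) ^+ 6)%:E.
Proof.
move=> r0; have mn := measurable_near1 r; have h1 := lebesgueC_near1 r0.
have h2 : muC2 (near1 r `*` near1 r) = ((2 * r) ^+ 2 * (2 * r) ^+ 2)%:E.
  exact: etrans (@product_sfmE _ _ _ _ _ mu1 mu1 _ _ mn mn) (congr2 mule h1 h1).
have mnn : measurable (near1 r `*` near1 r) by exact: measurableX.
apply: etrans (@product_sfmE _ _ _ _ _ muC2 mu1 _ _ mnn mn) _.
by apply: etrans (congr2 mule h2 h1) _; rewrite -EFinM; congr EFin; ring.
Qed.

Lemma muV_window_gt0 r : 0 < r -> (0 < muV (window r))%E.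
Proof. by move=> r0; rewrite muV_window// lte_fin exprn_gt0// mulr_gt0. Qed.

Lemma muV_gt0 : (0 < muV setT)%E.
Proof.
apply: (lt_le_trans (muV_window_gt0 ltr01)); apply: le_measure => //;
  by rewrite inE//; exact: measurable_window.
Qed.

End triples.

(** * Alternating functions of triples and the cocycle inequality *)

Section alternation.
Context {R : realType}.
Local Notation C := R[i].
Local Notation V := (C * C * C)%type.
Local Notation mu1 := (lebesgueC R).
Implicit Types (f : C * C -> R) (p q : V) (z : V * V).

Definition regular p := (p \is a GRing.unit) && (p.1.1 + p.1.2 + p.2 != 0).

(* Antisymmetrising makes the symmetries hold everywhere, not only almost
   everywhere. *)
Definition alt f p : R := if regular p then
  6^-1 * (f (affine_coords p) + f (affine_coords (rot1 p))
    + f (affine_coords (rot2 p)) - f (affine_coords (swap12 p))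
    - f (affine_coords (swap23 p)) - f (affine_coords (swap13 p))) else 0.

Definition scal (k : C) p : V := (k * p.1.1, k * p.1.2, k * p.2).

Lemma regular_swap12 p : regular (swap12 p) = regular p.
Proof.
rewrite /regular !unit_tripleE /= [p.1.2 + _]addrC.
by congr (_ && _); rewrite andbCA.
Qed.

Lemma regular_swap23 p : regular (swap23 p) = regular p.
Proof.
rewrite /regular !unit_tripleE /= addrAC.
by congr (_ && _); rewrite [X in _ && X]andbC.
Qed.

Lemma regular_rot1 p : regular (rot1 p) = regular p.
Proof. by rewrite -[rot1 p]/(swap23 (swap12 p)) regular_swap23 regular_swap12. Qed.

Lemma regular_rot2 p : regular (rot2 p) = regular p.
Proof. by rewrite -[rot2 p]/(swap12 (swap23 p)) regular_swap12 regular_swap23. Qed.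

Lemma regular_swap13 p : regular (swap13 p) = regular p.
Proof. by rewrite -[swap13 p]/(rot2 (swap12 p)) regular_rot2 regular_swap12. Qed.

Lemma alt_swap12 f p : alt f (swap12 p) = - alt f p.
Proof.
rewrite /alt regular_swap12; case: ifP => _; last by rewrite oppr0.
by case: p => -[a b] c; rewrite /rot1 /rot2 /swap12 /swap23 /swap13 /=; ring.
Qed.

Lemma alt_swap23 f p : alt f (swap23 p) = - alt f p.
Proof.
rewrite /alt regular_swap23; case: ifP => _; last by rewrite oppr0.
by case: p => -[a b] c; rewrite /rot1 /rot2 /swap12 /swap23 /swap13 /=; ring.
Qed.

Lemma alt_rot1 f p : alt f (rot1 p) = alt f p.
Proof. by rewrite -[rot1 p]/(swap23 (swap12 p)) alt_swap23 alt_swap12 opprK. Qed.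

Lemma alt_rot2 f p : alt f (rot2 p) = alt f p.
Proof. by rewrite -[rot2 p]/(swap12 (swap23 p)) alt_swap12 alt_swap23 opprK. Qed.

Lemma alt_swap13 f p : alt f (swap13 p) = - alt f p.
Proof. by rewrite -[swap13 p]/(rot2 (swap12 p)) alt_rot2 alt_swap12. Qed.

Lemma regular_scal (k : C) p : k != 0 -> regular (scal k p) = regular p.
Proof.
move=> k0; rewrite /regular !unit_tripleE /= -!mulrDr.
by rewrite !mulf_eq0 (negbTE k0).
Qed.

Lemma affine_coords_scal (k : C) p : k != 0 ->
  affine_coords (scal k p) = affine_coords p.
Proof. by move=> k0; rewrite /affine_coords /= invfM mulrACA (mulrACA k p.2) divff// !mul1r. Qed.

Lemma alt_scal f (k : C) p : k != 0 -> alt f (scal k p) = alt f p.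
Proof.
move=> k0; rewrite /alt regular_scal//; case: ifP => // _.
rewrite -[rot1 (scal k p)]/(scal k (rot1 p)) -[rot2 (scal k p)]/(scal k (rot2 p)).
rewrite -[swap12 (scal k p)]/(scal k (swap12 p)).
rewrite -[swap23 (scal k p)]/(scal k (swap23 p)).
by rewrite -[swap13 (scal k p)]/(scal k (swap13 p)) !affine_coords_scal.
Qed.

Lemma U4_affine_coords p : regular p -> U4 R (affine_coords p).
Proof.
rewrite /regular unit_tripleE => /andP[/and3P[a0 b0 c0] s0].
rewrite /U4 /affine_coords /= !(mulf_eq0, oppr_eq0, invr_eq0).
rewrite (negbTE a0) (negbTE b0) (negbTE c0) /=.
rewrite opprK -(divff a0) -!mulrDl mulf_eq0 invr_eq0 (negbTE a0) orbF.
exact: s0.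
Qed.

Lemma affine_coordsK (x y : C) : affine_coords (1, - x, y) = (x, y).
Proof. by rewrite /affine_coords /= !divr1 opprK. Qed.

Lemma scal_affine_coords p : p.1.1 != 0 ->
  scal p.1.1 (1, - (affine_coords p).1, (affine_coords p).2) = p.
Proof.
case: p => -[a b] c /= a0; rewrite /scal /= opprK mulr1.
by rewrite ![a * (_ / _)]mulrC !divfK.
Qed.

(** The six maps of the definition are the permutations of (1, -x, y) read in affine coordinates, so
    all six terms of [alt] agree with f(x, y) after their signs. Homogeneity of [alt] carries the
    identity from this slice to all triples. *)
Lemma alt_ae_eq f : alternating_S4 f ->
  \forall p \ae muV, regular p -> alt f p = f (affine_coords p).
Proof.
move=> [ev od].
have e1 := ev (fun t => (- (1 / t.2), - (t.1 / t.2))) (or_introl (or_intror erefl)).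
have e2 := ev (fun t => (t.2 / t.1, - (1 / t.1))) (or_intror erefl).
have o1 := od (fun t => (1 / t.1, - (t.2 / t.1))) (or_introl (or_introl erefl)).
have o2 := od (fun t => (- t.2, - t.1)) (or_introl (or_intror erefl)).
have o3 := od (fun t => (t.1 / t.2, 1 / t.2)) (or_intror erefl).
have key : \forall t \ae muC2, U4 R t -> alt f (1, - t.1, t.2) = f t.
  have h : \forall t \ae muC2, U4 R t ->
      [/\ f (- (1 / t.2), - (t.1 / t.2)) = f t,
          f (t.2 / t.1, - (1 / t.1)) = f t,
          f (1 / t.1, - (t.2 / t.1)) = - f t,
          f (- t.2, - t.1) = - f t & f (t.1 / t.2, 1 / t.2) = - f t].
    apply: filterS2 (filterI e1 e2) (filterI (filterI o1 o2) o3).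
    by move=> t [h1 h2] [[h3 h4] h5] Ut; split;
      [exact: h1|exact: h2|exact: h3|exact: h4|exact: h5].
  apply: filterS h => -[x y] h Uxy.
  have {h}[/= h1 h2 h3 h4 h5] := h Uxy.
  have r : regular (1, - x, y).
    move: Uxy; rewrite /regular unit_tripleE /U4 /= oner_eq0 oppr_eq0 !mulf_eq0.
    by rewrite !negb_or.
  have E1 : affine_coords (rot1 (1, - x, y)) = (y / x, - (1 / x)).
    by rewrite /affine_coords /=; congr (_, _); rewrite invrN mulrN ?opprK.
  have E2 : affine_coords (rot2 (1, - x, y)) = (- (1 / y), - (x / y)).
    by rewrite /affine_coords /=; congr (_, _); rewrite mulNr.
  have E3 : affine_coords (swap12 (1, - x, y)) = (1 / x, - (y / x)).
    by rewrite /affine_coords /=; congr (_, _); rewrite invrN mulrN ?opprK.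
  have E4 : affine_coords (swap23 (1, - x, y)) = (- y, - x).
    by rewrite /affine_coords /= !divr1.
  have E5 : affine_coords (swap13 (1, - x, y)) = (x / y, 1 / y).
    by rewrite /affine_coords /= mulNr opprK.
  rewrite /alt r affine_coordsK E1 E2 E3 E4 E5 h1 h2 h3 h4 h5.
  by field.
apply: filterS (nonsingular_ae nonsingular_affine_coords key) => p h rp.
have /andP[+ _] := rp; rewrite unit_tripleE => /and3P[a0 _ _].
rewrite -{1}(scal_affine_coords a0) alt_scal//; apply: h.
exact: U4_affine_coords.
Qed.

End alternation.

Lemma Linf_norm_leP d (T : measurableType d) (R : realType)
    (mu : {measure set T -> \bar R}) (U : set T) (h : T -> R) (K : R) : 0 <= K ->
  (Linf_norm mu U h <= K%:E)%E <-> \forall x \ae mu, U x -> `|h x| <= K.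
Proof.
move=> K0.
have E : (\forall x \ae mu, ((abse \o (EFin \o (h \_ U))) x <= K%:E)%E) <->
    \forall x \ae mu, U x -> `|h x| <= K.
  split; apply: filterS => x /=; rewrite patchE lee_fin.
    by move=> + Ux; rewrite mem_set.
  by case: ifPn => [/set_mem Ux /(_ Ux)//|_ _]; rewrite normr0.
(* The norm is an essential supremum when the space has positive measure, and 0 by convention
   otherwise. *)
rewrite -E /Linf_norm unlock; case: ifPn => [_|].
  by split => /ess_supP.
rewrite -leNgt measure_le0 => /eqP mu0; split => // _.
exact: measure0_ae.
Qed.

(** * The five faces of a configuration of five points *)

Section five_points.
Context {R : realType}.
Local Notation C := R[i].
Local Notation V := (C * C * C)%type.
Local Notation mu1 := (lebesgueC R).
Implicit Types (f : C * C -> R) (p q : V) (z : V * V).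

Definition neg2 : V := (1, -1, 1).
Definition neg23 : V := (1, -1, -1).

Lemma unit_neg2 : neg2 \is a GRing.unit.
Proof. by rewrite unit_tripleE /= oppr_eq0 oner_eq0. Qed.

Lemma unit_neg23 : neg23 \is a GRing.unit.
Proof. by rewrite unit_tripleE /= oppr_eq0 oner_eq0. Qed.

(** The six entries of [z] label, up to sign, the edges of a tetrahedron on four of the points, by
    their symplectic product; products with the fifth point are normalised to 1. The entries of
    [z.1] bound one triangle and each entry of [z.2] is the edge opposite to the corresponding entry
    of [z.1]. Omitting the fifth point gives the products of opposite edges, [face0]; omitting any
    other point gives a triangle. *)
Definition face0 z : V := neg23 * (z.1 * z.2).
Definition face12 z : V := mix12 z.
Definition face13 z : V := neg2 * mix13 z.
Definition face23 z : V := neg2 * mix23 z.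

Lemma nonsingular_face0 : nonsingular (muV \xs muV) muV face0.
Proof.
exact: (nonsingular_comp (nonsingular_mulV unit_neg23) nonsingular_mulVV).
Qed.

Lemma nonsingular_face13 : nonsingular (muV \xs muV) muV face13.
Proof.
exact: (nonsingular_comp (nonsingular_mulV unit_neg2) nonsingular_mix13).
Qed.

Lemma nonsingular_face23 : nonsingular (muV \xs muV) muV face23.
Proof.
exact: (nonsingular_comp (nonsingular_mulV unit_neg2) nonsingular_mix23).
Qed.

Definition cocycle (F : V -> R) z :=
  F (face0 z) - F z.1 - F (face12 z) - F (face13 z) - F (face23 z).

Lemma ae_regular : \forall p \ae @muV R, regular p.
Proof.
have ms : measurable_fun setT (fun p : V => p.1.1 + p.1.2 + p.2).
  apply: measurable_funC_D; last exact: measurable_snd.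
  by apply: measurable_funC_D; apply: measurableT_comp.
pose N := (fun p : V => p.1.1 + p.1.2 + p.2) @^-1` [set 0].
have mN : measurable N.
  by rewrite -[X in measurable X]setTI; apply: ms => //; exact: measurable_set1C.
have N0 : muV N = 0%E.
  apply/(@product_null_xsection _ _ _ _ _ muC2 mu1) => //.
  apply: aeW => -[a b].
  rewrite (_ : xsection N (a, b) = [set - (a + b)]); first exact: lebesgueC_set1.
  apply/seteqP; split => c; rewrite /xsection /N /= inE /=.
    by move/eqP; rewrite addrC addr_eq0 => /eqP.
  by move=> ->; rewrite addrC addNr.
have h : \forall p \ae @muV R, p.1.1 + p.1.2 + p.2 != 0.
  by exists N; split => // p /= /negP/negPn/eqP.
by apply: filterS2 ae_unit h => p pu ps; rewrite /regular pu.
Qed.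

(* Gauge in which the symplectic products with the omitted point are 1. *)
Definition pentuple z : C5 R :=
  (- (z.2.1.2 / z.2.1.1), - (z.2.2 / z.2.1.1), z.1.2 / z.2.1.1,
   - (z.1.1.2 / z.2.1.1), z.1.1.1 / z.2.1.1).

Local Notation muC5 := (mu1 \xs mu1 \xs mu1 \xs mu1 \xs mu1).

(** The coordinates u and v depend on d = [z.2] alone; for fixed d the other three are the reversed
    [z.1] scaled by 1/d1 up to sign. This is a skew map over d. *)
Lemma nonsingular_pentuple : nonsingular (muV \xs muV) muC5 pentuple.
Proof.
pose h (p : V) : C * C := (- (p.1.2 / p.1.1), - (p.2 / p.1.1)).
have nh : nonsingular muV muC2 h.
  have n1 : (-1 : C) != 0 by rewrite oppr_eq0 oner_eq0.
  have s := nonsingular_pair (nonsingular_id mu1) (scales_nonsingular (scales_mulC n1)).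
  have := nonsingular_comp s nonsingular_affine_coords.
  congr nonsingular; apply/funext => -[[a b] c].
  by rewrite /h /affine_coords /= mulN1r.
pose k (d : V) : V := (d.1.1^-1, - d.1.1^-1, d.1.1^-1).
have mg : measurable_fun setT (fun z : V * V => k z.1 * swap13 z.2).
  apply: measurable_mulV.
    have m : measurable_fun setT (fun z : V * V => z.1.1.1^-1).
      by apply: measurable_funC_V; apply: measurable_fun_11.
    apply: measurable_fun_triple => //=; exact: measurable_funC_N.
  by apply: measurable_fun_triple => /=;
    [apply: measurable_fun_2|apply: measurable_fun_12|apply: measurable_fun_11].
have nT : nonsingular (muV \xs muV) (muC2 \xs muV)
    (fun z => (h z.1, k z.1 * swap13 z.2)).
  apply: (@nonsingular_skew _ _ _ _ _ _ _ _ _ muV muV muC2 muV h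
    (fun d p => k d * swap13 p)) => //.
  apply: filterS ae_unit => d; rewrite unit_tripleE => /and3P[d0 _ _].
  apply: (nonsingular_comp (nonsingular_mulV _) nonsingular_swap13).
  by rewrite unit_tripleE /= oppr_eq0 invr_eq0 d0.
have a1 := nonsingular_assocV muC2 muC2 mu1.
have a2 := nonsingular_pair (nonsingular_assocV muC2 mu1 mu1) (nonsingular_id mu1).
have := nonsingular_comp a2 (nonsingular_comp a1 (nonsingular_comp nT (nonsingular_swap muV muV))).
congr nonsingular; apply/funext => -[[[p1 p2] p3] [[d1 d2] d3]].
rewrite /pentuple /h /k /=; congr (_, _, _, _, _).
- by rewrite mulrC.
- by rewrite mulNr mulrC.
- by rewrite mulrC.
Qed.

End five_points.

Section cocycle_bound.
Context {R : realType}.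
Local Notation C := R[i].
Local Notation V := (C * C * C)%type.
Implicit Types (f : C * C -> R) (p q : V) (z : V * V).

Definition regular5 z := [/\ regular (face0 z), regular z.1,
  regular (face12 z), regular (face13 z) & regular (face23 z)].

Lemma ae_regular5 : \forall z \ae @muV R \xs @muV R, regular5 z.
Proof.
have h0 := nonsingular_ae nonsingular_face0 (@ae_regular R).
have h1 := nonsingular_ae (nonsingular_fst muV muV) (@ae_regular R).
have h2 := nonsingular_ae nonsingular_mix12 (@ae_regular R).
have h3 := nonsingular_ae nonsingular_face13 (@ae_regular R).
have h4 := nonsingular_ae nonsingular_face23 (@ae_regular R).
apply: filterS3 (filterI h0 h1) (filterI h2 h3) h4.
by move=> z [] ? ? [].
Qed.

Lemma regularP (a b c : C) : regular (a, b, c) ->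
  [/\ a != 0, b != 0, c != 0 & a + b + c != 0].
Proof. by rewrite /regular unit_tripleE /= => /andP[/and3P[]]. Qed.

Lemma U5_pentuple z : regular5 z -> U5 R (pentuple z).
Proof.
case: z => [[[p1 p2] p3] [[d1 d2] d3]].
rewrite /regular5 /face0 /face12 /face13 /face23 /pentuple /U5 /=.
move=> [/regularP[_ _ _ s0] /regularP[p10 p20 p30 s1] /regularP[d10 d20 _ s2]].
move=> /regularP[_ _ d30 s3] /regularP[_ _ _ s4].
move: d30 s0 s3 s4; rewrite /= !mul1r !mulN1r => d30 s0 s3 s4.
have nz (a b : C) : a = b / d1 -> b != 0 -> a != 0.
  by move=> -> b0; rewrite mulf_neq0// invr_eq0.
split.
- by rewrite !oppr_eq0; split; rewrite mulf_neq0// invr_eq0.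
- apply: (nz _ ((p1 * d1 - p2 * d2 - p3 * d3) / d1)); last first.
    by rewrite mulf_neq0// invr_eq0.
  by field.
- by apply: (nz _ (p1 + p2 + p3)) => //; field.
- by apply: (nz _ (p1 - d2 + d3)) => //; field.
- apply/andP; split.
    by apply: (nz _ (d1 - p2 + d3)) => //; field.
  by apply: (nz _ (d1 + d2 + p3)) => //; field.
Qed.

(** The arguments of f in D are the affine coordinates of the five listed triples, which are
    permuted faces. The odd permutations among them account for the difference between the
    alternating signs of D and the signs of [cocycle]. *)
Lemma Dop_pentuple f z : regular5 z ->
  (forall t, t \in [:: face12 z; swap23 (face13 z); rot1 (face23 z);
      swap13 z.1; swap13 (face0 z)] -> alt f t = f (affine_coords t)) ->
  Dop f (pentuple z) = - cocycle (alt f) z.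
Proof.
move=> /[dup] r5 [r0 r1 r2 r3 r4] H.
have {H} [H4 H3 H2 H1 H0] : [/\ alt f (face12 z) = f (affine_coords (face12 z)),
   alt f (swap23 (face13 z)) = f (affine_coords (swap23 (face13 z))),
   alt f (rot1 (face23 z)) = f (affine_coords (rot1 (face23 z))),
   alt f (swap13 z.1) = f (affine_coords (swap13 z.1)) &
   alt f (swap13 (face0 z)) = f (affine_coords (swap13 (face0 z)))].
  by split; apply: H; rewrite !inE eqxx ?orbT.
move: H0 H1 H2 H3 H4.
rewrite alt_swap23 alt_rot1 !alt_swap13 /cocycle => H0 H1 H2 H3 ->.
rewrite H2 (canRL (@opprK _) H3) (canRL (@opprK _) H1) (canRL (@opprK _) H0).
move: r0 r1 r2 r3 r4; clear.
case: z => [[[p1 p2] p3] [[d1 d2] d3]].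
rewrite /regular5 /face0 /face12 /face13 /face23 /pentuple /=.
move=> /regularP[_ _ _ s0] /regularP[p10 p20 p30 s1] /regularP[d10 d20 _ s2].
move=> /regularP[_ _ d30 s3] /regularP[_ _ _ s4].
move: d30; rewrite /= !mul1r => d30.
have E0 : (- (d2 / d1) * - (p2 / d1) / (- (d3 / d1) * (p3 / d1)),
    p1 / d1 / (- (d3 / d1) * (p3 / d1))) =
    affine_coords (swap13 (neg23 * ((p1, p2, p3) * (d1, d2, d3)))) :> C * C.
  by rewrite /affine_coords /=; congr (_, _); field; rewrite d10 d30 p30.
have E1 : (- (p2 / d1) / (p3 / d1), p1 / d1 / (p3 / d1)) =
    affine_coords (swap13 (p1, p2, p3)) :> C * C.
  by rewrite /affine_coords /=; congr (_, _); field; rewrite d10 p30.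
have E2 : (- (d3 / d1) / - (d2 / d1), p1 / d1 / - (d2 / d1)) =
    affine_coords (rot1 (neg2 * mix23 (p1, p2, p3, (d1, d2, d3)))) :> C * C.
  by rewrite /affine_coords /=; congr (_, _); field; rewrite d10 d20.
have E3 : (- (d3 / d1), - (p2 / d1)) =
    affine_coords (swap23 (neg2 * mix13 (p1, p2, p3, (d1, d2, d3)))) :> C * C.
  by rewrite /affine_coords /=; congr (_, _); field.
rewrite /Dop E0 E1 E2 E3.
rewrite (_ : (- (d2 / d1), p3 / d1) = affine_coords (mix12 (p1, p2, p3, (d1, d2, d3))))//.
by ring.
Qed.

Lemma cocycle_ae_bound f (M : R) : alternating_S4 f ->
  (\forall x \ae lebesgueC5 R, U5 R x -> `|Dop f x| <= M) ->
  \forall z \ae @muV R \xs @muV R, `|cocycle (alt f) z| <= M.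
Proof.
move=> f_alt fM.
have {}fM := nonsingular_ae (nonsingular_pentuple : nonsingular _ (lebesgueC5 R) _) fM.
have af := alt_ae_eq f_alt.
have h0 := nonsingular_ae (nonsingular_comp nonsingular_swap13 nonsingular_face0) af.
have h1 := nonsingular_ae (nonsingular_comp nonsingular_swap13 (nonsingular_fst muV muV)) af.
have h2 := nonsingular_ae nonsingular_mix12 af.
have h3 := nonsingular_ae (nonsingular_comp nonsingular_swap23 nonsingular_face13) af.
have h4 := nonsingular_ae (nonsingular_comp nonsingular_rot1 nonsingular_face23) af.
apply: filterS2 (filterI (filterI h0 h1) (filterI (filterI h2 h3) h4)) (filterI ae_regular5 fM).
move=> z [[f0 f1] [[f2 f3] f4]] [r5 fMz]; have {fMz} := fMz (U5_pentuple r5).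
rewrite Dop_pentuple ?normrN//.
have [r0 r1 r2 r3 r4] := r5.
move=> t; rewrite !inE => /orP[/eqP->|/orP[/eqP->|/orP[/eqP->|/orP[/eqP->|/eqP->]]]].
- exact: f2.
- by apply: f3; rewrite /= regular_swap23.
- by apply: f4; rewrite /= regular_rot1.
- by apply: f1; rewrite /= regular_swap13.
- by apply: f0; rewrite /= regular_swap13.
Qed.

End cocycle_bound.

(** * Sign changes and mean values for alternating functions *)

Section alternating_cocycles.
Context {R : realType}.
Local Notation C := R[i].
Local Notation V := (C * C * C)%type.
Implicit Types (p q d : V) (z : V * V).
Variables (F : V -> R) (M : R).
Hypothesis F12 : forall p, F (swap12 p) = - F p.
Hypothesis F23 : forall p, F (swap23 p) = - F p.
Hypothesis Fscal : forall (k : C) p, k != 0 -> F (scal k p) = F p.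
Hypothesis FM : \forall z \ae @muV R \xs @muV R, `|cocycle F z| <= M.

Lemma alternating_swap13 p : F (swap13 p) = - F p.
Proof.
by rewrite -[swap13 p]/(swap12 (swap23 (swap12 p))) F12 F23 F12 !opprK.
Qed.

Lemma homogeneous_opp (a b c : C) : F (- a, - b, - c) = F (a, b, c).
Proof.
rewrite -(Fscal (a, b, c) (_ : -1 != 0 :> C)) ?oppr_eq0 ?oner_eq0//.
by rewrite /scal /= !mulN1r.
Qed.

Lemma mul_tripleE (a b c x y z : C) :
  (a, b, c) * (x, y, z) = (a * x, b * y, c * z) :> V.
Proof. by []. Qed.

Lemma cocycleE (X Y Z a b c : C) : cocycle F ((X, Y, Z), (a, b, c)) =
  F (X * a, - (Y * b), - (Z * c)) - F (X, Y, Z) - F (a, b, Z) - F (a, - Y, c)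
    - F (X, - b, c).
Proof.
rewrite /cocycle /face0 /face12 /face13 /face23 /neg2 /neg23 /mix12 /mix13 /mix23.
by rewrite /= !mul_tripleE !mul1r !mulN1r.
Qed.

Lemma cocycle_ae_fibre : \forall p \ae @muV R, \forall d \ae muV, `|cocycle F (p, d)| <= M.
Proof. exact: ae_prod FM. Qed.

Definition neg3 : V := (1, 1, -1).

Lemma unit_neg3 : neg3 \is a GRing.unit.
Proof. by rewrite unit_tripleE /= oppr_eq0 oner_eq0. Qed.

(** With p0 = (X, Y, Z) and d = (a, b, c), subtract from the cocycle at (p0, d) the one with Z
    negated: the two faces not involving Z cancel. Do the same after exchanging the first two
    entries of p0 and d. In the sum of both differences, the terms F(X, Y, Z), F(a, b, Z) and their
    variants with -Z cancel by alternation, and the product face is left twice. Four inequalities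
    thus give 4 M for twice the difference. As p0 is fixed and invertible, the product face runs
    over almost every triple. *)
Lemma ae_neg3 : \forall p \ae muV, `|F p - F (neg3 * p)| <= 2 * M.
Proof.
have Q := cocycle_ae_fibre.
have Q3 := nonsingular_ae (nonsingular_mulV unit_neg3) Q.
have Q12 := nonsingular_ae nonsingular_swap12 Q.
have Q312 := nonsingular_ae nonsingular_swap12 Q3.
have [p0 _ [p0u [[h1 h2] [h3 h4]]]] := ae_exists measurableT muV_gt0
  (filterI (@ae_unit R) (filterI (filterI Q Q3) (filterI Q12 Q312))).
have {h3}h3 := nonsingular_ae nonsingular_swap12 h3.
have {h4}h4 := nonsingular_ae nonsingular_swap12 h4.
have ku : neg23 * p0 \is a GRing.unit by rewrite unitrM unit_neg23.
have kv : (neg23 * p0)^-1 \is a GRing.unit by rewrite unitrV.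
suff H : \forall d \ae muV, `|F (neg23 * p0 * d) - F (neg3 * (neg23 * p0 * d))| <= 2 * M.
  by apply: filterS (nonsingular_ae (nonsingular_mulV kv) H) => p; rewrite mulVKr.
apply: filterS2 (filterI h1 h2) (filterI h3 h4) => d [].
case: p0 {p0u h1 h2 h3 h4 ku kv} => -[X Y] Z; case: d => -[a b] c.
rewrite /swap12 /neg23 /neg3 !mul_tripleE /= !mul1r !mulN1r !cocycleE => c1 c2 [c3 c4].
have e12 (i j k : C) : F (j, i, k) = - F (i, j, k) by exact: (F12 (i, j, k)).
move: c3 c4; rewrite (e12 X) (e12 a) (e12 X Y (- Z)) (e12 a b (- Z)).
rewrite (e12 (- (X * a)) (Y * b)) (e12 (- (X * a)) (Y * b) (- (- Z * c))).
rewrite -(homogeneous_opp (- (X * a))) -(homogeneous_opp (- (X * a)) (Y * b) (- (- Z * c))) !opprK.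
move: c1 c2; rewrite !mulNr !opprK.
repeat match goal with |- context [F ?x] => move: (F x) => ? end.
clear Q Q3 Q12 Q312 e12.
rewrite !ler_norml => /andP[? ?] /andP[? ?] /andP[? ?] /andP[? ?].
by apply/andP; split; lra.
Qed.

Lemma ae_neg2 : \forall p \ae muV, `|F p - F (neg2 * p)| <= 2 * M.
Proof.
apply: filterS (nonsingular_ae nonsingular_swap23 ae_neg3) => p.
rewrite (_ : neg3 * swap23 p = swap23 (neg2 * p)); last by case: p => -[].
by rewrite !F23 -opprD normrN.
Qed.

Definition orbit_sum p d := F (p * d) + F (p * rot1 d) + F (p * rot2 d)
  + F (p * swap12 d) + F (p * swap23 d) + F (p * swap13 d).

(** Even rearrangements of d carry the signs of [neg23] and odd ones the opposite signs. The nine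
    mixed faces from the even ones are then transposes of the nine from the odd ones, so they cancel
    in the sum, while homogeneity makes the extra sign invisible on the product face. *)
Lemma ae_mean_value : \forall p \ae @muV R, \forall d \ae muV,
  `|6 * F p - orbit_sum p d| <= 6 * M.
Proof.
have nu : -1 * neg23 \is a @GRing.unit V.
  by rewrite unitrM unit_neg23 unitrN1.
apply: filterS cocycle_ae_fibre => p h.
have n0 := nonsingular_ae (nonsingular_mulV unit_neg23) h.
have n1 := nonsingular_ae nonsingular_rot1 n0.
have n2 := nonsingular_ae nonsingular_rot2 n0.
have {h} h := nonsingular_ae (nonsingular_mulV nu) h.
have n3 := nonsingular_ae nonsingular_swap12 h.
have n4 := nonsingular_ae nonsingular_swap23 h.
have n5 := nonsingular_ae nonsingular_swap13 h.
apply: filterS2 (filterI (filterI n0 n1) n2) (filterI (filterI n3 n4) n5) => d.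
case: p {h n0 n1 n2 n3 n4 n5} => -[X Y] Z; case: d => -[x y] z.
rewrite /orbit_sum /rot1 /rot2 /swap12 /swap23 /swap13 /neg23 /=.
rewrite (_ : -1 * _ = (-1, 1, 1)); last first.
  by rewrite [LHS]mulN1r; congr (_, _, _); rewrite opprK.
rewrite !mul_tripleE !mul1r !mulN1r !cocycleE !mulrN !opprK.
have e12 (i j k : C) : F (j, i, k) = - F (i, j, k) by exact: (F12 (i, j, k)).
have e23 (i j k : C) : F (i, k, j) = - F (i, j, k) by exact: (F23 (i, j, k)).
have e13 (i j k : C) : F (k, j, i) = - F (i, j, k) by exact: (alternating_swap13 (i, j, k)).
rewrite (homogeneous_opp (X * y)) (homogeneous_opp (X * x)) (homogeneous_opp (X * z)).
rewrite (e12 x (- y)) (e12 y (- z)) (e12 z (- x)).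
rewrite (e23 _ x (- y)) (e23 _ y (- z)) (e23 _ z (- x)).
rewrite (e13 z _ (- y)) (e13 y _ (- x)) (e13 x _ (- z)).
rewrite !ler_norml => -[[/andP[? ?] /andP[? ?]] /andP[? ?]].
move=> [[/andP[? ?] /andP[? ?]] /andP[? ?]].
by apply/andP; split; lra.
Qed.

End alternating_cocycles.

(** * Growth, contraction and local boundedness *)

Section sqnorm_theory.
Context {R : realType}.
Local Notation C := R[i].
Local Notation V := (C * C * C)%type.

Lemma sqnorm_ge0 (x : C) : 0 <= sqnorm x.
Proof. by rewrite addr_ge0// sqr_ge0. Qed.

Lemma sqnormM (x y : C) : sqnorm (x * y) = sqnorm x * sqnorm y.
Proof. by case: x y => a b [c d]; rewrite /sqnorm /=; ring. Qed.

Lemma sqnormN (x : C) : sqnorm (- x) = sqnorm x.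
Proof. by case: x => a b; rewrite /sqnorm /= !sqrrN. Qed.

Lemma sqnorm1 : sqnorm (1 : C) = 1.
Proof. by rewrite /sqnorm /= expr1n expr0n addr0. Qed.

Lemma sqnormV (x : C) : x != 0 -> sqnorm x^-1 = (sqnorm x)^-1.
Proof.
move=> x0; apply: (mulfI (lt0r_neq0 (sqnorm_gt0 x0))).
by rewrite -sqnormM !divff ?sqnorm1// gt_eqF// sqnorm_gt0.
Qed.

(** Rounded to an interval stable under inversion, the form that [invr_bounds] and
    [comparable3_perturb] handle. *)
Lemma sqnorm_near1 (x : C) : near1 2^-1 x -> 4^-1 <= sqnorm x <= 4.
Proof.
case: x => a b [] /=; rewrite !in_itv /= => /andP[a1 a2] /andP[b1 b2].
by rewrite /sqnorm /=; apply/andP; split; nra.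
Qed.

Definition comparable3 (S x y z : R) : Prop :=
  [/\ x <= S * y, y <= S * x & x <= S * z] /\
  [/\ z <= S * x, y <= S * z & z <= S * y].

Definition ball3 (S : R) (p : V) : Prop :=
  comparable3 S (sqnorm p.1.1) (sqnorm p.1.2) (sqnorm p.2).

Lemma ball3_swap12 S p : ball3 S p -> ball3 S (swap12 p).
Proof. by case=> -[? ? ?] [? ? ?]; do 2!split. Qed.

Lemma ball3_swap23 S p : ball3 S p -> ball3 S (swap23 p).
Proof. by case=> -[? ? ?] [? ? ?]; do 2!split. Qed.

Lemma comparable3_le S T x y z : 0 <= x -> 0 <= y -> 0 <= z -> S <= T ->
  comparable3 S x y z -> comparable3 T x y z.
Proof.
by move=> x0 y0 z0 ST [[h1 h2 h3] [h4 h5 h6]]; do 2!split;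
  apply: le_trans; [exact: h1|exact: ler_wpM2r|exact: h2|exact: ler_wpM2r|
  exact: h3|exact: ler_wpM2r|exact: h4|exact: ler_wpM2r|exact: h5|
  exact: ler_wpM2r|exact: h6|exact: ler_wpM2r].
Qed.

Lemma ball3_le S T p : S <= T -> ball3 S p -> ball3 T p.
Proof. by apply: comparable3_le; exact: sqnorm_ge0. Qed.

Lemma perturb_le (c t x y f g : R) : 0 < c -> 0 <= t -> 0 <= x -> 0 <= y ->
  x <= t * y -> f <= c -> c^-1 <= g -> x * f <= c ^+ 2 * t * (y * g).
Proof.
move=> c0 t0 x0 y0 xy fc cg.
apply: (@le_trans _ _ (t * y * c)).
  by apply: (le_trans (ler_wpM2l x0 fc)); apply: ler_wpM2r => //; exact: ltW.
rewrite -[leLHS]mulr1 (_ : c ^+ 2 * t * (y * g) = t * y * c * (c * g)); last by ring.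
apply: ler_wpM2l; first by rewrite !mulr_ge0// ltW.
by rewrite -ler_pdivrMl// mulr1.
Qed.

(** Source of the constants of the radii: c = 4 for one factor from the window of radius 1/2 gives
    16, and c = 16 for a product of two such factors gives 256. *)
Lemma comparable3_perturb (c t x y z f g h : R) : 0 < c -> 0 <= t ->
  0 <= x -> 0 <= y -> 0 <= z -> c^-1 <= f <= c -> c^-1 <= g <= c ->
  c^-1 <= h <= c -> comparable3 t x y z ->
  comparable3 (c ^+ 2 * t) (x * f) (y * g) (z * h).
Proof.
move=> c0 t0 x0 y0 z0 /andP[? ?] /andP[? ?] /andP[? ?] [[? ? ?] [? ? ?]].
by do 2!split; apply: perturb_le.
Qed.

Lemma invr_bounds (c x : R) : 0 < c -> c^-1 <= x <= c -> c^-1 <= x^-1 <= c.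
Proof.
move=> c0 /andP[cx xc]; have x0 : 0 < x by apply: lt_le_trans cx; rewrite invr_gt0.
by rewrite lef_pV2 ?posrE// xc /= -[leRHS]invrK lef_pV2 ?posrE ?invr_gt0.
Qed.

End sqnorm_theory.

(** * Growth of bounds when the radius is squared *)

Section growth.
Context {R : realType}.
Local Notation C := R[i].
Local Notation V := (C * C * C)%type.
Implicit Types (p q d : V) (z : V * V).
Variables (F : V -> R) (M : R).
Hypothesis F12 : forall p, F (swap12 p) = - F p.
Hypothesis F23 : forall p, F (swap23 p) = - F p.
Hypothesis FM : \forall z \ae @muV R \xs @muV R, `|cocycle F z| <= M.

Definition bounded_on_ball (S K : R) :=
  \forall p \ae @muV R, ball3 S p -> `|F p| <= K.

(** Chosen so that, for invertible d, [face0] of [with_product (p, d)] is p: the cocycle inequality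
    is parametrised by its product face. *)
Definition invdir (d : V) : V := (d.1.1^-1, - d.1.2^-1, - d.2^-1).

Definition with_product z : V * V := (z.1 * invdir z.2, z.2).

Lemma nonsingular_with_product :
  nonsingular (muV \xs muV) (@muV R \xs muV) with_product.
Proof.
have h : nonsingular (muV \xs muV) (muV \xs muV)
    (fun z => (z.1, invdir z.1 * z.2)).
  apply: nonsingular_skewV.
    apply: measurable_fun_triple => /=.
    - by apply: measurable_funC_V; apply: measurable_fun_11.
    - by apply: measurable_funC_N; apply: measurable_funC_V; apply: measurable_fun_12.
    - by apply: measurable_funC_N; apply: measurable_funC_V; apply: measurable_fun_2.
  apply: filterS ae_unit => d; rewrite !unit_tripleE /= !oppr_eq0 !invr_eq0.
  by [].
have := nonsingular_comp (nonsingular_swap muV muV)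
  (nonsingular_comp h (nonsingular_swap muV muV)).
by congr nonsingular; apply/funext => -[p d]; rewrite /with_product /= mulrC.
Qed.

Let good K S z := [/\ `|cocycle F z| <= M, ball3 S z.1 -> `|F z.1| <= K,
  ball3 S (face13 z) -> `|F (face13 z)| <= K &
  ball3 S (face23 z) -> `|F (face23 z)| <= K].

Let ae_good K S : bounded_on_ball S K -> \forall p \ae @muV R, \forall d \ae @muV R,
  good K S (with_product (p, d)) /\ good K S (with_product (p, swap12 d)).
Proof.
move=> SK.
have h1 := nonsingular_ae (nonsingular_fst muV muV) SK.
have h2 := nonsingular_ae nonsingular_face13 SK.
have h3 := nonsingular_ae nonsingular_face23 SK.
have {h1 h2 h3 SK}h : \forall z \ae @muV R \xs @muV R, good K S z.
  by apply: filterS2 (filterI FM h1) (filterI h2 h3) => z [? ?] [].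
have n := nonsingular_with_product.
have n' := nonsingular_comp n (nonsingular_pair (nonsingular_id muV) nonsingular_swap12).
exact: ae_prod (filterI (nonsingular_ae n h) (nonsingular_ae n' h)).
Qed.

(** The faces F(a, b, -Z/c) and F(b, a, -Z/c) are opposite, so they vanish from the sum of the two
    inequalities. Three bounded faces remain in each, whence the factor 3 instead of 4, without
    which the contraction would not win. *)
Lemma product_le_faces (K : R) (X Y Z a b c : C) :
  a != 0 -> b != 0 -> c != 0 ->
  `|cocycle F ((X / a, - (Y / b), - (Z / c)), (a, b, c))| <= M ->
  `|cocycle F ((X / b, - (Y / a), - (Z / c)), (b, a, c))| <= M ->
  `|F (X / a, - (Y / b), - (Z / c))| <= K ->
  `|F (X / b, - (Y / a), - (Z / c))| <= K ->
  `|F (a, Y / b, c)| <= K -> `|F (b, Y / a, c)| <= K ->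
  `|F (X / a, - b, c)| <= K -> `|F (X / b, - a, c)| <= K ->
  `|F (X, Y, Z)| <= 3 * K + M.
Proof.
move=> a0 b0 c0; rewrite !cocycleE !mulNr !opprK !divfK//.
have -> : F (b, a, - (Z / c)) = - F (a, b, - (Z / c)) by exact: (F12 (a, b, _)).
repeat match goal with |- context [F ?x] => move: (F x) => ? end.
rewrite !ler_norml => /andP[? ?] /andP[? ?] /andP[? ?] /andP[? ?].
move=> /andP[? ?] /andP[? ?] /andP[? ?] /andP[? ?].
by apply/andP; split; lra.
Qed.

Let product_le (K S : R) (X Y Z a b c : C) :
  a != 0 -> b != 0 -> c != 0 ->
  good K S (with_product ((X, Y, Z), (a, b, c))) ->
  good K S (with_product ((X, Y, Z), swap12 (a, b, c))) ->
  ball3 S (X / a, Y / b, Z / c) -> ball3 S (X / b, Y / a, Z / c) ->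
  ball3 S (a, Y / b, c) -> ball3 S (b, Y / a, c) ->
  ball3 S (X / a, b, c) -> ball3 S (X / b, a, c) ->
  `|F (X, Y, Z)| <= 3 * K + M.
Proof.
move=> a0 b0 c0; rewrite /good /with_product /swap12 /invdir /face13 /face23.
rewrite /mix13 /mix23 /neg2 /= !mul_tripleE !mul1r !mulN1r !mulrN !opprK.
move=> [c1 g1 g2 g3] [c1' g1' g2' g3'] b1 b1' b2 b2' b3 b3'.
apply: (@product_le_faces K _ _ _ a b c) => //.
- by apply: g1; move: b1; rewrite /ball3 /= !sqnormN.
- by apply: g1'; move: b1'; rewrite /ball3 /= !sqnormN.
- exact: g2.
- exact: g2'.
- by apply: g3; move: b3; rewrite /ball3 /= !sqnormN.
- by apply: g3'; move: b3'; rewrite /ball3 /= !sqnormN.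
Qed.

Lemma comparable3_between (t x y z : R) : 0 < x -> 0 < y -> 0 < z -> 0 < t ->
  y <= t * z -> z <= t * y -> (y <= x <= z) || (z <= x <= y) ->
  comparable3 t x y z /\ comparable3 t y y z.
Proof.
move=> x0 y0 z0 t0 yz zy h.
have t1 : 1 <= t.
  have : y <= t ^+ 2 * y.
    by rewrite expr2 -mulrA (le_trans yz)// ler_wpM2l// ltW.
  by rewrite -[leLHS]mul1r ler_pM2r// -[X in X <= _](expr1n _ 2) ler_sqr// nnegrE ltW.
have tx : x <= t * x by rewrite ler_peMl// ltW.
have ty : y <= t * y by rewrite ler_peMl// ltW.
have tz : z <= t * z by rewrite ler_peMl// ltW.
have tm u v : u <= v -> t * u <= t * v by move=> uv; rewrite ler_wpM2l// ltW.
case/orP: h => /andP[h1 h2]; have := tm _ _ h1; have := tm _ _ h2 => ? ?;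
  by do 4?split; lra.
Qed.

(* The condition for [sqnorm X] to lie between [sqnorm Y] and
   [sqrt (sqnorm Y * sqnorm Z)]; it holds for p up to a permutation. *)
Let middle (p : V) := let: (X, Y, Z) := p in
  (sqnorm Y <= sqnorm X /\ sqnorm X ^+ 2 <= sqnorm Y * sqnorm Z) \/
  (sqnorm X <= sqnorm Y /\ sqnorm Y * sqnorm Z <= sqnorm X ^+ 2).

(** The first two entries of d have comparable moduli because the estimate also uses [swap12 d]. The
    quotient p / d then has squared moduli about [sqnorm X / B], [B] and [G], and [middle] places
    the first of these between the other two, so that every face has ratios at most 16 t. *)
Let growth_middle (K t : R) p : 0 < t -> p \is a GRing.unit ->
  ball3 (t ^+ 2) p -> middle p ->
  (\forall d \ae @muV R, good K (16 * t) (with_product (p, d)) /\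
     good K (16 * t) (with_product (p, swap12 d))) -> `|F p| <= 3 * K + M.
Proof.
case: p => -[X Y] Z t0; rewrite unit_tripleE /= => /and3P[X0 Y0 Z0].
rewrite /ball3 /= => -[_ [_ YZ ZY]] mid ae_p.
have sX := sqnorm_gt0 X0; have sY := sqnorm_gt0 Y0; have sZ := sqnorm_gt0 Z0.
(* The triple d has squared moduli B, B, G up to a factor 4, so that p / d has
   squared moduli close to [sqnorm X / B], B, G. *)
pose B := Num.sqrt (sqnorm Y); pose G := Num.sqrt (sqnorm Z).
have B0 : 0 < B by rewrite sqrtr_gt0.
have G0 : 0 < G by rewrite sqrtr_gt0.
have BB : B ^+ 2 = sqnorm Y by rewrite sqr_sqrtr// ltW.
have GG : G ^+ 2 = sqnorm Z by rewrite sqr_sqrtr// ltW.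
have sq_le (x y : R) : 0 <= x -> 0 <= y -> x ^+ 2 <= y ^+ 2 -> x <= y.
  by move=> x0 y0; rewrite ler_sqr.
have BG : B <= t * G.
  by apply: sq_le; [exact: ltW|by rewrite mulr_ge0// ltW|rewrite exprMn BB GG].
have GB : G <= t * B.
  by apply: sq_le; [exact: ltW|by rewrite mulr_ge0// ltW|rewrite exprMn BB GG].
have U0 : 0 < sqnorm X / B by rewrite divr_gt0.
have [cmp1 cmp2] : comparable3 t (sqnorm X / B) B G /\ comparable3 t B B G.
  apply: comparable3_between => //.
  rewrite !(ler_pdivlMr _ _ B0) !(ler_pdivrMr _ _ B0) -expr2 BB.
  case: mid => -[h1 h2]; apply/orP; [left|right]; rewrite h1 ?andbT //=;
    by apply: sq_le; [by rewrite ?mulr_ge0// ltW|by rewrite ?mulr_ge0// ltW|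
      rewrite exprMn BB GG mulrC].
pose kb : C := (Num.sqrt B +i* 0)%C; pose kg : C := (Num.sqrt G +i* 0)%C.
have skb : sqnorm kb = B by rewrite /sqnorm /= expr0n addr0 sqr_sqrtr// ltW.
have skg : sqnorm kg = G by rewrite /sqnorm /= expr0n addr0 sqr_sqrtr// ltW.
have kb0 : kb != 0 by rewrite eq_complex /= eqxx andbT gt_eqF// sqrtr_gt0.
have kg0 : kg != 0 by rewrite eq_complex /= eqxx andbT gt_eqF// sqrtr_gt0.
have ku : (kb, kb, kg) \is a @GRing.unit V by rewrite unit_tripleE /= kb0 kg0.
have h2 : (0 : R) < 2^-1 by rewrite invr_gt0.
have {ae_p}ae_p := nonsingular_ae (nonsingular_mulV ku) ae_p.
have [[[x y] z] [[/= xn yn] zn] [zu]] := ae_exists (measurable_window 2^-1)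
  (muV_window_gt0 h2) (filterI (@ae_unit R) ae_p).
move: zu; rewrite unit_tripleE /= => /and3P[x0 y0 z0].
rewrite mul_tripleE => -[g1 g2].
have {xn}xn := sqnorm_near1 xn; have {yn}yn := sqnorm_near1 yn.
have {zn}zn := sqnorm_near1 zn.
have c0 : (0 : R) < 4 by [].
have xn' := invr_bounds c0 xn; have yn' := invr_bounds c0 yn.
have zn' := invr_bounds c0 zn.
have a0 : kb * x != 0 by rewrite mulf_neq0.
have b0 : kb * y != 0 by rewrite mulf_neq0.
have e0 : kg * z != 0 by rewrite mulf_neq0.
have sqX u : u != 0 -> sqnorm (X / (kb * u)) = sqnorm X / B * (sqnorm u)^-1.
  by move=> u0; rewrite sqnormM sqnormV ?mulf_neq0// sqnormM skb invfM mulrA.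
have sqY u : u != 0 -> sqnorm (Y / (kb * u)) = B * (sqnorm u)^-1.
  move=> u0; rewrite sqnormM sqnormV ?mulf_neq0// sqnormM skb invfM mulrA -BB.
  by rewrite expr2 mulfK// gt_eqF.
have sqZ u : u != 0 -> sqnorm (Z / (kg * u)) = G * (sqnorm u)^-1.
  move=> u0; rewrite sqnormM sqnormV ?mulf_neq0// sqnormM skg invfM mulrA -GG.
  by rewrite expr2 mulfK// gt_eqF.
have c16 : (16 : R) = 4 ^+ 2 by ring.
have ltWs := (ltW U0, ltW B0, ltW G0, ltW t0).
rewrite c16 in g1 g2.
apply: (@product_le K (4 ^+ 2 * t) _ _ _ (kb * x) (kb * y) (kg * z)) => //;
  rewrite /ball3 /= ?sqX ?sqY ?sqZ// ?[sqnorm (kb * _)]sqnormM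
  ?[sqnorm (kg * _)]sqnormM ?skb ?skg;
  by apply: comparable3_perturb; rewrite ?ltWs.
Qed.

Let middleE (X Y Z : C) : (sqnorm Y <= sqnorm X <= sqnorm Z) ->
  middle (X, Y, Z) \/ middle (X, Z, Y).
Proof.
move=> /andP[YX XZ]; have [h|h] := lerP (sqnorm X ^+ 2) (sqnorm Y * sqnorm Z).
  by left; left.
by right; right; split => //; rewrite mulrC ltW.
Qed.

Let middleE' (X Y Z : C) : (sqnorm Y <= sqnorm X <= sqnorm Z) ->
  middle (X, Z, Y) \/ middle (X, Y, Z).
Proof. by move/middleE => []; [right|left]. Qed.

Lemma bounded_growth (K t : R) : 0 < t ->
  bounded_on_ball (16 * t) K -> bounded_on_ball (t ^+ 2) (3 * K + M).
Proof.
move=> t0 tK.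
have h : \forall p \ae @muV R, ball3 (t ^+ 2) p -> middle p -> `|F p| <= 3 * K + M.
  apply: filterS2 (@ae_unit R) (ae_good tK) => p pu g b m.
  exact: growth_middle t0 pu b m g.
have h12 := nonsingular_ae nonsingular_swap12 h.
have h23 := nonsingular_ae nonsingular_swap23 h.
have h13 := nonsingular_ae nonsingular_swap13 h.
have r1 := nonsingular_ae nonsingular_rot1 h.
have r2 := nonsingular_ae nonsingular_rot2 h.
apply: filterS3 (filterI h h12) (filterI h23 h13) (filterI r1 r2) => p.
move=> [q q12] [q23 q13] [q1 q2] b.
have b12 := ball3_swap12 b; have b23 := ball3_swap23 b.
have b1 : ball3 (t ^+ 2) (rot1 p) by exact: (ball3_swap23 b12).
have b2 : ball3 (t ^+ 2) (rot2 p) by exact: (ball3_swap12 b23).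
have b13 : ball3 (t ^+ 2) (swap13 p) by exact: (ball3_swap12 b1).
(* The entry of intermediate modulus is put first; its position relative to the geometric mean of
   the two extremes decides which extreme comes second. *)
suff : [\/ middle p \/ middle (swap23 p), middle (swap12 p) \/ middle (rot1 p)
    | middle (rot2 p) \/ middle (swap13 p)].
  have N x : `|F (swap12 x)| = `|F x| by rewrite F12 normrN.
  have N' x : `|F (swap23 x)| = `|F x| by rewrite F23 normrN.
  have e1 : `|F (rot1 p)| = `|F p| by rewrite -[rot1 p]/(swap23 (swap12 p)) N' N.
  have e2 : `|F (rot2 p)| = `|F p| by rewrite -[rot2 p]/(swap12 (swap23 p)) N N'.
  have e3 : `|F (swap13 p)| = `|F p| by rewrite -[swap13 p]/(swap12 (rot1 p)) N.
  case=> -[] m; [exact: q|rewrite -N'; exact: q23|rewrite -N; exact: q12|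
    rewrite -e1; exact: q1|rewrite -e2; exact: q2|rewrite -e3; exact: q13].
case: p {q q12 q23 q13 q1 q2 b b12 b23 b1 b2 b13} => -[X Y] Z.
rewrite /swap12 /swap23 /swap13 /rot1 /rot2 /=.
case/orP: (le_total (sqnorm X) (sqnorm Y)) => ?;
case/orP: (le_total (sqnorm Y) (sqnorm Z)) => ?;
case/orP: (le_total (sqnorm X) (sqnorm Z)) => ?.
all: try by (constructor 1; apply: middleE; apply/andP).
all: try by (constructor 1; apply: middleE'; apply/andP).
all: try by (constructor 2; apply: middleE; apply/andP).
all: try by (constructor 2; apply: middleE'; apply/andP).
all: try by (constructor 3; apply: middleE; apply/andP).
all: try by (constructor 3; apply: middleE'; apply/andP).
Qed.

End growth.

(** * Contraction of bounds by a factor 4 *)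

Section contraction.
Context {R : realType}.
Local Notation C := R[i].
Local Notation V := (C * C * C)%type.
Implicit Types (p q d : V) (z : V * V).
Variables (F : V -> R) (M : R).
Hypothesis F12 : forall p, F (swap12 p) = - F p.
Hypothesis F23 : forall p, F (swap23 p) = - F p.
Hypothesis Fscal : forall (k : C) p, k != 0 -> F (scal k p) = F p.
Hypothesis FM : \forall z \ae @muV R \xs @muV R, `|cocycle F z| <= M.

Definition in_orbit (P : V -> Prop) q d :=
  [/\ P (q * d), P (q * rot1 d) & P (q * rot2 d)] /\
  [/\ P (q * swap12 d), P (q * swap23 d) & P (q * swap13 d)].

Lemma ae_in_orbit (P : V -> Prop) q : q \is a GRing.unit ->
  (\forall p \ae @muV R, P p) -> \forall d \ae @muV R, in_orbit P q d.
Proof.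
move=> /nonsingular_mulV nq /(nonsingular_ae nq) h.
have h1 := nonsingular_ae nonsingular_rot1 h.
have h2 := nonsingular_ae nonsingular_rot2 h.
have h3 := nonsingular_ae nonsingular_swap12 h.
have h4 := nonsingular_ae nonsingular_swap23 h.
have h5 := nonsingular_ae nonsingular_swap13 h.
apply: filterS3 (filterI h h1) (filterI h2 h3) (filterI h4 h5).
by move=> d [? ?] [? ?] [? ?].
Qed.

Definition in_orbit2 (P : V * V -> Prop) q z := let s h := (q * h z.1, q * h z.2) in
  [/\ P (s id), P (s rot1) & P (s rot2)] /\
  [/\ P (s swap12), P (s swap23) & P (s swap13)].

Lemma ae_in_orbit2 (P : V * V -> Prop) q : q \is a GRing.unit ->
  (\forall z \ae @muV R \xs @muV R, P z) ->
  \forall z \ae @muV R \xs @muV R, in_orbit2 P q z.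
Proof.
move=> /nonsingular_mulV nq h.
have H (g : V -> V) : nonsingular muV muV g ->
    \forall z \ae @muV R \xs @muV R, P (q * g z.1, q * g z.2).
  move=> ng; have n := nonsingular_comp nq ng.
  exact: nonsingular_ae (nonsingular_pair n n) h.
have h0 := H _ (nonsingular_id _).
have h1 := H _ nonsingular_rot1; have h2 := H _ nonsingular_rot2.
have h3 := H _ nonsingular_swap12; have h4 := H _ nonsingular_swap23.
have h5 := H _ nonsingular_swap13.
apply: filterS3 (filterI h0 h1) (filterI h2 h3) (filterI h4 h5).
by move=> z [? ?] [? ?] [? ?].
Qed.

Let mean_value q d := `|6 * F q - orbit_sum F q d| <= 6 * M /\
  in_orbit (fun p => `|F p - F (neg2 * p)| <= 2 * M) q d.

Let ae_mean_value_orbit : \forall q \ae @muV R, \forall d \ae @muV R, mean_value q d.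
Proof.
apply: filterS2 (@ae_unit R) (ae_mean_value F12 F23 Fscal FM) => q qu h.
exact: filterI h (ae_in_orbit qu (ae_neg2 F12 F23 Fscal FM)).
Qed.

(** Sum the cocycle inequalities over the six permutations, at the cost of 6 M. The first terms form
    the orbit sum of [z.1]; the eighteen mixed faces are those of the orbit sums of [mix12 z],
    [mix13 z] and [mix23 z], twelve of them with a sign change costing 2 M each. Replacing each of
    the four orbit sums by 6 F(q) costs 6 M. Altogether 24 |F(q)| is at most 6 K + 54 M. *)
Lemma contraction_pointwise (K : R) q z :
  in_orbit2 (fun z => `|cocycle F z| <= M /\ `|F (face0 z)| <= K) q z ->
  mean_value q z.1 -> mean_value q (mix12 z) -> mean_value q (mix13 z) -> mean_value q (mix23 z) ->
  `|F q| <= (K + 9 * M) / 4.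
Proof.
case: q z => -[a b] c [[[x y] z] [[u v] w]].
rewrite /in_orbit2 /mean_value /in_orbit /orbit_sum /mix12 /mix13 /mix23 /face0 /neg2 /neg23.
rewrite /rot1 /rot2 /swap12 /swap23 /swap13 /= !mul_tripleE !mul1r !mulN1r !cocycleE.
repeat match goal with |- context [F ?x] => move: (F x) => ? end.
clear a b c x y z u v w.
move=> [[[c1 l1] [c2 l2] [c3 l3]] [[c4 l4] [c5 l5] [c6 l6]]].
move=> [m1 _] [m2 [[s1 s2 s3] [s4 s5 s6]]].
move=> [m3 [[t1 t2 t3] [t4 t5 t6]]] [m4 [[r1 r2 r3] [r4 r5 r6]]].
rewrite !ler_norml in c1 c2 c3 c4 c5 c6 l1 l2 l3 l4 l5 l6 m1 m2 m3 m4
  s1 s2 s3 s4 s5 s6 t1 t2 t3 t4 t5 t6 r1 r2 r3 r4 r5 r6 *.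
move: c1 c2 c3 c4 c5 c6 l1 l2 l3 l4 l5 l6 m1 m2 m3 m4
  s1 s2 s3 s4 s5 s6 t1 t2 t3 t4 t5 t6 r1 r2 r3 r4 r5 r6.
do 34 (move=> /andP[? ?]).
apply/andP; split; lra.
Qed.

Lemma ball3_face0 (S : R) q p d : 0 <= S -> ball3 S q ->
  window 2^-1 p -> window 2^-1 d -> ball3 (256 * S ^+ 2) (face0 (q * p, q * d)).
Proof.
case: q p d => -[a b] c [[x y] z] [[u v] w] S0 [[h1 h2 h3] [h4 h5 h6]].
move=> [[/= /sqnorm_near1 x4 /sqnorm_near1 y4] /sqnorm_near1 z4].
move=> [[/= /sqnorm_near1 u4 /sqnorm_near1 v4] /sqnorm_near1 w4].
rewrite /face0 /= !mul_tripleE /ball3 /= !mul1r !mulN1r !sqnormN !sqnormM.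
have bnd (s t : R) : 4^-1 <= s <= 4 -> 4^-1 <= t <= 4 -> 16^-1 <= s * t <= 16.
  by move=> /andP[? ?] /andP[? ?]; apply/andP; split; nra.
have E (r s t : R) : r * s * (r * t) = r ^+ 2 * (s * t) by ring.
rewrite !E (_ : 256 = 16 ^+ 2 :> R); last by ring.
have sq (s t : R) : 0 <= s -> 0 <= t -> s <= S * t -> s ^+ 2 <= S ^+ 2 * t ^+ 2.
  by move=> s0 t0 st; rewrite -exprMn lerXn2r// nnegrE mulr_ge0.
apply: comparable3_perturb; rewrite ?sqr_ge0 ?bnd//.
by do 2!split; apply: sq; rewrite ?sqnorm_ge0.
Qed.

Lemma bounded_contraction (K S : R) : 0 <= S ->
  bounded_on_ball F (256 * S ^+ 2) K -> bounded_on_ball F S ((K + 9 * M) / 4).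
Proof.
move=> S0 SK.
apply: filterS2 (@ae_unit R) ae_mean_value_orbit => q qu q_mv qS.
have h : \forall z \ae @muV R \xs @muV R, in_orbit2 (fun z =>
    `|cocycle F z| <= M /\
    (ball3 (256 * S ^+ 2) (face0 z) -> `|F (face0 z)| <= K)) q z.
  apply: ae_in_orbit2 => //.
  exact: filterI FM (nonsingular_ae nonsingular_face0 SK).
have m0 := nonsingular_ae (nonsingular_fst muV muV) q_mv.
have m1 := nonsingular_ae nonsingular_mix12 q_mv.
have m2 := nonsingular_ae nonsingular_mix13 q_mv.
have m3 := nonsingular_ae nonsingular_mix23 q_mv.
have h2 : (0 : R) < 2^-1 by rewrite invr_gt0.
have mW := @measurable_window R 2^-1.
have W0 : (0 < (@muV R \xs muV) (window 2^-1 `*` window 2^-1))%E.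
  rewrite (@product_sfmE _ _ _ _ _ muV muV)//.
  by rewrite mule_gt0// muV_window_gt0.
have [z [w1 w2] [hz [[mz0 mz1] [mz2 mz3]]]] := ae_exists (measurableX mW mW) W0
  (filterI h (filterI (filterI m0 m1) (filterI m2 m3))).
apply: contraction_pointwise mz0 mz1 mz2 mz3.
have perms (g : V -> V) : (forall p, window 2^-1 p -> window 2^-1 (g p)) ->
    (`|cocycle F (q * g z.1, q * g z.2)| <= M /\
     (ball3 (256 * S ^+ 2) (face0 (q * g z.1, q * g z.2)) ->
      `|F (face0 (q * g z.1, q * g z.2))| <= K)) ->
    `|cocycle F (q * g z.1, q * g z.2)| <= M /\
    `|F (face0 (q * g z.1, q * g z.2))| <= K.
  by move=> gw [? hK]; split=> //; apply: hK; apply: ball3_face0 => //; exact: gw.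
case: hz => -[g0 g1 g2] [g3 g4 g5].
have w_id p : window 2^-1 p -> window 2^-1 (id p) by [].
have w_r1 p : window 2^-1 p -> window 2^-1 (rot1 p) by move=> [[]].
have w_r2 p : window 2^-1 p -> window 2^-1 (rot2 p) by move=> [[]].
have w_12 p : window 2^-1 p -> window 2^-1 (swap12 p) by move=> [[]].
have w_23 p : window 2^-1 p -> window 2^-1 (swap23 p) by move=> [[]].
have w_13 p : window 2^-1 p -> window 2^-1 (swap13 p) by move=> [[]].
have {}g0 := perms _ w_id g0; have {}g1 := perms _ w_r1 g1.
have {}g2 := perms _ w_r2 g2; have {}g3 := perms _ w_12 g3.
have {}g4 := perms _ w_23 g4; have {}g5 := perms _ w_13 g5.
exact: (conj (And3 g0 g1 g2) (And3 g3 g4 g5)).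
Qed.

End contraction.

(** * Local boundedness from the mean value inequality *)

Section local_bound.
Context {R : realType}.
Local Notation C := R[i].
Local Notation V := (C * C * C)%type.
Local Notation mu1 := (lebesgueC R).
Implicit Types (p q d : V) (z : V * V).

Definition box (L : R) : set V :=
  let I := [set z : C | `[- L, L]%classic (complex.Re z) /\
                        `[- L, L]%classic (complex.Im z)] in
  I `*` I `*` I.

Lemma measurable_box L : measurable (box L).
Proof.
by apply: measurableX; [apply: measurableX|]; exact: measurable_rectC.
Qed.

Lemma muV_box L : (muV (box L) < +oo)%E.
Proof.
rewrite /box; set I := (X in X `*` X `*` X).
have mI : measurable I by exact: measurable_rectC.
have fI : (mu1 I < +oo)%E.
  rewrite lebesgueC_rect// lebesgue_measure_itv/= lte_fin.
  by case: ifP => _; rewrite ?mule0 ?ltry// -EFinB -EFinM ltry.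
have mII : measurable (I `*` I) by exact: measurableX.
have fin : muV (I `*` I `*` I) = (mu1 I * mu1 I * mu1 I)%E.
  apply: etrans (@product_sfmE _ _ _ _ _ muC2 mu1 _ _ mII mI) _.
  by congr (_ * _)%E; exact: (@product_sfmE _ _ _ _ _ mu1 mu1 _ _ mI mI).
rewrite fin lte_mul_pinfty//; first by rewrite mule_ge0.
by rewrite fin_numM// ge0_fin_numE.
Qed.

Lemma box_sqnorm (S : R) p : 1 <= S -> sqnorm p.1.1 <= 4 * S ->
  sqnorm p.1.2 <= 4 * S -> sqnorm p.2 <= 4 * S -> box (2 * S) p.
Proof.
move=> S1; have h (z : C) : sqnorm z <= 4 * S ->
    `[- (2 * S), 2 * S]%classic (complex.Re z) /\
    `[- (2 * S), 2 * S]%classic (complex.Im z).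
  case: z => a b; rewrite /sqnorm /= !in_itv /= => ab.
  by split; apply/andP; split; nra.
by move=> h1 h2 h3; split; [split|]; apply: h.
Qed.

Let six_sevenths : 7^-1 + 7^-1 + 7^-1 + 7^-1 + 7^-1 + 7^-1 <= 6 / 7 :> R.
Proof. lra. Qed.

Variables (F : V -> R).
Hypothesis mF : measurable_fun setT F.

Let bad L n : set V := box L `&` [set p | n%:R < `|F p|].

Let measurable_bad L n : measurable (bad L n).
Proof.
apply: measurableI; first exact: measurable_box.
rewrite (_ : [set p | _] = (fun p => `|F p|) @^-1` `]n%:R, +oo[%classic); last first.
  by apply/seteqP; split => p /=; rewrite in_itv /= andbT.
have mA : measurable_fun setT (fun p => `|F p|) by apply: measurableT_comp.
by rewrite -[X in measurable X]setTI; exact: mA.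
Qed.

(** Continuity from above: [F] is finite everywhere, so the sets decrease to the empty set inside a
    box of finite measure. *)
Lemma bad_small L (e : R) : 0 < e -> exists n, (muV (bad L n) < e%:E)%E.
Proof.
move=> e0.
have h : (muV \o bad L) n @[n --> \oo] --> muV (\bigcap_n bad L n).
  apply: nonincreasing_cvg_mu.
  - by apply: (le_lt_trans _ (muV_box L)); apply: le_measure;
      rewrite ?inE//; [exact: measurable_box|move=> p []].
  - by move=> n; exact: measurable_bad.
  - by apply: bigcapT_measurable => n; exact: measurable_bad.
  - move=> m n mn; apply/subsetPset => p [bp /= np]; split => //=.
    by apply: le_lt_trans np; rewrite ler_nat.
have I0 : \bigcap_n bad L n = set0.
  apply/seteqP; split => // p h0.
  have [_ /=] := h0 (Num.truncn `|F p|).+1 I.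
  by apply/negP; rewrite -leNgt; apply/ltW/truncnS_gt.
rewrite I0 measure0 in h.
have [n _ hn] : \forall n \near \oo, ((muV \o bad L) n < e%:E)%E.
  apply: (h [set y | (y < e%:E)%E]); apply: open_nbhs_nbhs; split; first exact: open_ereal_lt_ereal.
  by rewrite /= lte_fin.
by exists n; exact: (hn n (leqnn n)).
Qed.

Variable M : R.
Hypothesis F12 : forall p, F (swap12 p) = - F p.
Hypothesis F23 : forall p, F (swap23 p) = - F p.
Hypothesis Fscal : forall (k : C) p, k != 0 -> F (scal k p) = F p.
Hypothesis FM : \forall z \ae @muV R \xs @muV R, `|cocycle F z| <= M.

Let dehom_unit q (p : V) : p \is a GRing.unit -> q \is a GRing.unit ->
  scal q.1.1^-1 p \is a GRing.unit.
Proof.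
rewrite !unit_tripleE => /and3P[? ? ?] /and3P[? ? ?].
by rewrite /= !mulf_neq0 ?invr_eq0.
Qed.

(** Dividing by the first entry of q removes the scale of q. The factor depends on p only through
    the product of its moduli, so the bound serves all permutations of q at once. *)
Let scaleV_le (S : R) q p : 1 <= S -> q \is a GRing.unit -> ball3 S q ->
  sqnorm p.1.1 * sqnorm p.1.2 * sqnorm p.2 =
    sqnorm q.1.1 * sqnorm q.1.2 * sqnorm q.2 ->
  scaleV (scal q.1.1^-1 p) <= S ^+ 2.
Proof.
case: q p => -[a b] c [[x y] z] S1; rewrite unit_tripleE /= => /and3P[a0 b0 c0].
move=> [[h1 _ h2] _] /= E; rewrite /scaleV /= !sqnormM !sqnormV// -!invfM.
set A := sqnorm a in h1 h2 E *.
have A0 : 0 < A by exact: sqnorm_gt0.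
rewrite (_ : _ * _ * _ = sqnorm x * sqnorm y * sqnorm z / A ^+ 3); last first.
  by field; rewrite gt_eqF.
rewrite E invf_div ler_pdivrMr ?mulr_gt0 ?sqnorm_gt0//.
have h : A * A <= S * sqnorm b * (S * sqnorm c).
  by rewrite ler_pM// ltW.
rewrite -(ler_pM2l A0) in h; move: h.
by rewrite [A ^+ 3](_ : _ = A * (A * A)) ?(mulrC (S ^+ 2));
  [move/le_trans; apply; rewrite le_eqVlt; apply/orP; left; apply/eqP; ring|ring].
Qed.

Lemma locally_bounded (S : R) : 1 <= S -> exists K, bounded_on_ball F S K.
Proof.
move=> S1; have S0 : 0 < S by lra.
(* Six exceptional sets must fit strictly inside a window of measure 1, hence 1/7 for each; S^2 is
   the scaling factor of [scaleV_le]. *)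
have e0 : 0 < (7 * S ^+ 2)^-1 by rewrite invr_gt0 mulr_gt0// exprn_gt0.
have [n bad_n] := bad_small (2 * S) e0.
exists (M + n%:R).
apply: filterS2 (@ae_unit R) (ae_mean_value F12 F23 Fscal FM) => q qu mean_value qS.
pose k (p : V) : V := scal q.1.1^-1 p.
pose A p : set V := *%R (k p) @^-1` bad (2 * S) n.
pose good p := p \is a GRing.unit /\ sqnorm p.1.1 * sqnorm p.1.2 * sqnorm p.2 =
    sqnorm q.1.1 * sqnorm q.1.2 * sqnorm q.2.
have mA p : good p -> measurable (A p).
  move=> [pu _]; rewrite /A -[X in measurable X]setTI.
  have [mk _] := scales_mulV (dehom_unit pu qu).
  by apply: mk => //; exact: measurable_bad.
have A_le p : good p -> (muV (A p) <= (7^-1)%:E)%E.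
  move=> [pu pE]; have [_ sk] := scales_mulV (dehom_unit pu qu).
  rewrite [muV _]sk; last exact: measurable_bad.
  apply: (@le_trans _ _ ((S ^+ 2)%:E * ((7 * S ^+ 2)^-1)%:E)%E).
    apply: lee_pmul => //; last exact: ltW.
      rewrite lee_fin /scaleV.
      by rewrite !mulr_ge0// invr_ge0 sqnorm_ge0.
    by rewrite lee_fin; exact: scaleV_le.
  by rewrite -EFinM lee_fin invfM mulrCA divff ?mulr1// expf_neq0// gt_eqF.
have q10 : q.1.1 != 0 by move: qu; rewrite unit_tripleE => /and3P[].
have F_le p d : good p -> [/\ sqnorm p.1.1 <= S * sqnorm q.1.1,
      sqnorm p.1.2 <= S * sqnorm q.1.1 & sqnorm p.2 <= S * sqnorm q.1.1] ->
    window 2^-1 d -> ~ A p d -> `|F (p * d)| <= n%:R.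
  move=> [pu _] [p1 p2 p3] [[d1 d2] d3] nA.
  have k0 : q.1.1^-1 != 0 by rewrite invr_eq0.
  have -> : F (p * d) = F (k p * d).
    rewrite -(Fscal (p * d) k0); congr F.
    by case: (p) (d) => -[a b] c [[x y] z]; rewrite /k /scal /= !mul_tripleE !mulrA.
  rewrite leNgt; apply/negP => hn; apply: nA; split => //.
  have sk (x y : C) : sqnorm x <= S * sqnorm q.1.1 -> near1 2^-1 y ->
      sqnorm (q.1.1^-1 * x * y) <= 4 * S.
    move=> xS /sqnorm_near1/andP[_ y4].
    rewrite !sqnormM sqnormV// mulrC ler_pM// ?sqnorm_ge0//.
      by rewrite mulr_ge0 ?invr_ge0 ?sqnorm_ge0.
    by rewrite ler_pdivrMl ?sqnorm_gt0// mulrC.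
  case: (p) (d) p1 p2 p3 d1 d2 d3 => -[a b] c [[x y] z] /= p1 p2 p3 d1 d2 d3.
  by apply: box_sqnorm => //=; exact: sk.
(* Alternation transfers a permutation of d to the inverse one of q, as in |F(q . rot1 d)| = |F(rot2
   q . d)|, so that all six conditions bear on the same d. *)
pose U := A q `|` A (rot2 q) `|` A (rot1 q) `|` A (swap12 q) `|` A (swap23 q)
  `|` A (swap13 q).
have g0 : good q by [].
have g1 : good (rot2 q).
  move: qu; rewrite /good !unit_tripleE; case: (q) => -[a b] c /=.
  by move=> /and3P[-> -> ->]; split=> //; ring.
have g2 : good (rot1 q).
  move: qu; rewrite /good !unit_tripleE; case: (q) => -[a b] c /=.
  by move=> /and3P[-> -> ->]; split=> //; ring.
have g3 : good (swap12 q).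
  move: qu; rewrite /good !unit_tripleE; case: (q) => -[a b] c /=.
  by move=> /and3P[-> -> ->]; split=> //; ring.
have g4 : good (swap23 q).
  move: qu; rewrite /good !unit_tripleE; case: (q) => -[a b] c /=.
  by move=> /and3P[-> -> ->]; split=> //; ring.
have g5 : good (swap13 q).
  move: qu; rewrite /good !unit_tripleE; case: (q) => -[a b] c /=.
  by move=> /and3P[-> -> ->]; split=> //; ring.
have mU : measurable U.
  by do ?[apply: measurableU]; apply: mA.
have h2 : (0 : R) < 2^-1 by rewrite invr_gt0.
have mW := @measurable_window R 2^-1.
have WU0 : (0 < muV (window 2^-1 `\` U))%E.
  rewrite lt_neqAle measure_ge0 andbT; apply/negP => /eqP/esym WU.
  have U_le : (muV U <= (6 / 7)%:E)%E.
    have step (X : set V) p c : measurable X -> good p -> (muV X <= c%:E)%E ->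
        (muV (X `|` A p) <= (c + 7^-1)%:E)%E.
      move=> mX gp Xc; apply: (le_trans (measureU2 _ mX (mA _ gp))).
      by rewrite EFinD leeD// A_le.
    have m1 := measurableU _ _ (mA _ g0) (mA _ g1).
    have m2 := measurableU _ _ m1 (mA _ g2); have m3 := measurableU _ _ m2 (mA _ g3).
    have m4 := measurableU _ _ m3 (mA _ g4).
    have s1 := step _ _ _ (mA _ g0) g1 (A_le _ g0).
    have s2 := step _ _ _ m1 g2 s1; have s3 := step _ _ _ m2 g3 s2.
    have s4 := step _ _ _ m3 g4 s3; have s5 := step _ _ _ m4 g5 s4.
    by apply: (le_trans s5); rewrite lee_fin; exact: six_sevenths.
  have : (muV (window 2^-1) <= muV (window 2^-1 `\` U) + muV U)%E.
    apply: (@le_trans _ _ (muV ((window 2^-1 `\` U) `|` U))); last first.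
      by apply: measureU2 => //; exact: measurableD.
    apply: le_measure; rewrite ?inE//; first by apply: measurableU => //; exact: measurableD.
    by move=> p wp; have [Up|nUp] := pselect (U p); [right|left].
  rewrite [X in (_ <= X + _)%E]WU add0e muV_window// => /le_trans/(_ U_le).
  by rewrite lee_fin; apply/negP; rewrite -ltNge divff// expr1n ltr_pdivrMr ?ltr0n// mul1r ltr_nat.
have [d [dW dU] {}mean_value] := ae_exists (measurableD mW mU) WU0 mean_value.
move: dU; rewrite /U => /not_orP[/not_orP[/not_orP[/not_orP[/not_orP[n0 n1] n2] n3] n4] n5].
have [[h12 _ h13] [_ _ _]] := qS.
have [[_ h21 _] [h31 _ _]] := qS.
have h11 : sqnorm q.1.1 <= S * sqnorm q.1.1.
  by rewrite ler_peMl// sqnorm_ge0.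
have N x : `|F (swap12 x)| = `|F x| by rewrite F12 normrN.
have N' x : `|F (swap23 x)| = `|F x| by rewrite F23 normrN.
have {n0}e0' : `|F (q * d)| <= n%:R by apply: F_le.
have {n1}e1 : `|F (q * rot1 d)| <= n%:R.
  rewrite -N' -N; have -> : swap12 (swap23 (q * rot1 d)) = rot2 q * d by [].
  by apply: F_le.
have {n2}e2 : `|F (q * rot2 d)| <= n%:R.
  rewrite -N -N'; have -> : swap23 (swap12 (q * rot2 d)) = rot1 q * d by [].
  by apply: F_le.
have {n3}e3 : `|F (q * swap12 d)| <= n%:R.
  by rewrite -N; have -> : swap12 (q * swap12 d) = swap12 q * d by []; apply: F_le.
have {n4}e4 : `|F (q * swap23 d)| <= n%:R.
  by rewrite -N'; have -> : swap23 (q * swap23 d) = swap23 q * d by []; apply: F_le.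
have {n5}e5 : `|F (q * swap13 d)| <= n%:R.
  rewrite -N -N' -N.
  by have -> : swap12 (swap23 (swap12 (q * swap13 d))) = swap13 q * d by []; apply: F_le.
move: mean_value e0' e1 e2 e3 e4 e5; rewrite /orbit_sum; clear.
repeat match goal with |- context [F ?x] => move: (F x) => ? end.
rewrite !ler_norml.
move=> /andP[? ?] /andP[? ?] /andP[? ?] /andP[? ?] /andP[? ?] /andP[? ?] /andP[? ?].
by apply/andP; split; lra.
Qed.

End local_bound.

(** * Growth against contraction *)

Section essential_bound.
Context {R : realType}.
Local Notation C := R[i].
Local Notation V := (C * C * C)%type.
Implicit Types (p q d : V) (z : V * V).
Variables (F : V -> R) (M : R).
Hypothesis mF : measurable_fun setT F.
Hypothesis F12 : forall p, F (swap12 p) = - F p.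
Hypothesis F23 : forall p, F (swap23 p) = - F p.
Hypothesis Fscal : forall (k : C) p, k != 0 -> F (scal k p) = F p.
Hypothesis FM : \forall z \ae @muV R \xs @muV R, `|cocycle F z| <= M.

Lemma bounded_on_ball_le (S T K L : R) : S <= T -> K <= L ->
  bounded_on_ball F T K -> bounded_on_ball F S L.
Proof.
move=> ST KL; apply: filterS => p h pS; apply: (le_trans _ KL); apply: h.
exact: ball3_le pS.
Qed.

(** The number -M/2 is the fixed point of K -> 3 K + M. The prefactor 256 = 16^2 turns the step from
    16 t to t^2 into the squaring of s. *)
Lemma iterated_growth (K s : R) j : 0 < s -> bounded_on_ball F (256 * s) K ->
  bounded_on_ball F (256 * s ^+ (2 ^ j)) (3 ^+ j * (K + M / 2) - M / 2).
Proof.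
move=> s0 h; elim: j => [|j IH].
  by rewrite expn0 expr1 expr0 mul1r addrK.
have t0 : 0 < 16 * s ^+ (2 ^ j) by rewrite mulr_gt0// exprn_gt0.
have := @bounded_growth R F M F12 F23 FM (3 ^+ j * (K + M / 2) - M / 2) _ t0.
rewrite mulrA (_ : 16 * 16 = 256 :> R); last by ring.
move=> /(_ IH); apply: bounded_on_ball_le.
  by rewrite exprMn -exprM -expnSr (_ : 16 ^+ 2 = 256 :> R)//; ring.
by rewrite exprS; lra.
Qed.

(** The number 3 M is the fixed point of K -> (K + 9 M) / 4; dividing the radius by 256 absorbs the
    constant of [bounded_contraction] in the same way. *)
Lemma iterated_contraction (K s : R) j : 0 < s ->
  bounded_on_ball F (s ^+ (2 ^ j) / 256) K ->
  bounded_on_ball F (s / 256) ((K - 3 * M) / 4 ^+ j + 3 * M).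
Proof.
elim: j s => [|j IH] s s0.
  by rewrite expn0 expr1 expr0 divr1 subrK.
rewrite expnS exprM => /(IH _ (exprn_gt0 _ s0)) h.
have S0 : 0 <= s / 256 by rewrite divr_ge0 ?ler0n// ltW.
have := @bounded_contraction R F M F12 F23 Fscal FM ((K - 3 * M) / 4 ^+ j + 3 * M) _ S0.
rewrite (_ : 256 * (s / 256) ^+ 2 = s ^+ 2 / 256); last by field.
move=> /(_ h); apply: bounded_on_ball_le => //.
by rewrite exprSr invfM; lra.
Qed.

Lemma cocycle_bound_ge0 : 0 <= M.
Proof.
have h2 : (0 < (@muV R \xs muV) setT)%E.
  rewrite -setXTT (@product_sfmE _ _ _ _ _ muV muV)//.
  by rewrite mule_gt0// muV_gt0.
have [z _ /(le_trans _)] := ae_exists measurableT h2 FM.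
by apply.
Qed.

Lemma essential_bound : \forall p \ae @muV R, `|F p| <= 3 * M.
Proof.
have M0 := cocycle_bound_ge0.
have h (n : nat) : \forall p \ae @muV R, ball3 (n.+1%:R / 256) p -> `|F p| <= 3 * M.
  have n1 : 1 <= n.+1%:R :> R by rewrite ler1n.
  have n0 : 0 < n.+1%:R :> R by rewrite ltr0n.
  have [|K nK] := @locally_bounded R F mF M F12 F23 Fscal FM (256 * n.+1%:R); first lra.
  have step j : \forall p \ae @muV R, ball3 (n.+1%:R / 256) p ->
      `|F p| <= (3 / 4) ^+ j * (K + M / 2) - (4 ^+ j)^-1 * (M / 2 + 3 * M) + 3 * M.
    have X0 : 0 <= n.+1%:R ^+ (2 ^ j) :> R by rewrite exprn_ge0.
    have le : n.+1%:R ^+ (2 ^ j) / 256 <= 256 * n.+1%:R ^+ (2 ^ j) :> R by lra.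
    have := bounded_on_ball_le le (lexx _) (iterated_growth j n0 nK).
    move=> /(iterated_contraction n0); apply: bounded_on_ball_le => //.
    by rewrite expr_div_n; lra.
  (* A single null set serves all j, so the limit in j can be taken at each point. *)
  have {step} := ae_foralln step.
  apply: filterS => p h pn; rewrite leNgt; apply/negP => Fp.
  have e0 : 0 < `|F p| - 3 * M by rewrite subr_gt0.
  have z1 : `|3 / 4 : R| < 1 by rewrite ger0_norm; lra.
  have [j _ /(_ j (leqnn j)) hj] := cvgr_lt _ (cvg_geometric `|K + M / 2| z1) _ e0.
  have := h j pn; apply/negP; rewrite -ltNge.
  have M4 : 0 <= (4 ^+ j)^-1 * (M / 2 + 3 * M).
    by rewrite mulr_ge0 ?invr_ge0 ?exprn_ge0//; lra.
  have A_le : (3 / 4) ^+ j * (K + M / 2) <= `|K + M / 2| * (3 / 4) ^+ j.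
    by rewrite mulrC ler_wpM2r ?ler_norm// exprn_ge0.
  by move: hj; rewrite /geometric /=; lra.
have {h} := ae_foralln h.
apply: filterS2 (@ae_unit R) => p; rewrite unit_tripleE => /and3P[a0 b0 c0] h.
have := sqnorm_gt0 a0; have := sqnorm_gt0 b0; have := sqnorm_gt0 c0.
set c := sqnorm p.2; set b := sqnorm p.1.2; set a := sqnorm p.1.1.
move=> c1 b1 a1; pose r (x y : R) := x / y + y / x.
have r_ge x y : 0 < x -> 0 < y -> x <= r x y * y /\ y <= r x y * x.
  move=> x1 y1; rewrite /r !mulrDl !divfK ?gt_eqF//.
  by split; rewrite ?lerDl ?lerDr !mulr_ge0// ?invr_ge0 ltW.
have r0 x y : 0 < x -> 0 < y -> 0 <= r x y.
  by move=> x1 y1; rewrite addr_ge0// divr_ge0// ltW.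
(* This sum dominates every ratio of two squared moduli, so each invertible triple lies in one of
   the countably many balls treated above. *)
pose S := r a b + r a c + r b c.
have rab := r0 _ _ a1 b1; have rac := r0 _ _ a1 c1; have rbc := r0 _ _ b1 c1.
have [ab ba] := r_ge _ _ a1 b1; have [ac ca] := r_ge _ _ a1 c1.
have [bc cb] := r_ge _ _ b1 c1.
have pS : ball3 S p.
  have le (x y u : R) : 0 < y -> u <= S -> x <= u * y -> x <= S * y.
    by move=> y1 uS /le_trans; apply; rewrite ler_wpM2r// ltW.
  by do 2!split; [apply: le ab|apply: le ba|apply: le ac|apply: le ca|apply: le bc
    |apply: le cb]; rewrite // /S; lra.
apply: (h (Num.truncn (256 * S))); apply: ball3_le pS.
by rewrite ler_pdivlMr ?ltr0n// mulrC ltW// truncnS_gt.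
Qed.
End essential_bound.

Section alternation_measurable.
Context {R : realType}.
Local Notation C := R[i].
Local Notation V := (C * C * C)%type.
Implicit Types (f : C * C -> R) (p : V).

Lemma measurable_neq0 d (T : measurableType d) (h : T -> C) :
  measurable_fun setT h -> measurable [set x | h x != 0].
Proof.
move=> mh; rewrite (_ : [set x | h x != 0] = ~` (h @^-1` [set 0])); last first.
  by apply/seteqP; split => x /=; [move=> /eqP|move=> /eqP].
apply: measurableC; rewrite -[X in measurable X]setTI; apply: mh => //.
exact: measurable_set1C.
Qed.

Lemma measurable_U4 : measurable (U4 R).
Proof.
rewrite (_ : U4 R = [set z : C * C | z.1 * z.2 * (1 - z.1 + z.2) != 0]); last first.
  by apply/seteqP; split => -[x y].
apply: measurable_neq0; apply: measurable_funC_M; first exact: measurable_funC_M.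
apply: measurable_funC_D => //; apply: measurable_funC_D => //.
exact: measurable_funC_N.
Qed.

Lemma measurable_regular : measurable [set p : V | regular p].
Proof.
rewrite (_ : [set p | _] = [set p : V | p.1.1 * p.1.2 * p.2 * (p.1.1 + p.1.2 + p.2) != 0]).
  have m1 : measurable_fun setT (fun p : V => p.1.1) by apply: measurable_fun_11.
  have m2 : measurable_fun setT (fun p : V => p.1.2) by apply: measurable_fun_12.
  have m3 : measurable_fun setT (fun p : V => p.2) by apply: measurable_fun_2.
  apply: measurable_neq0; apply: measurable_funC_M.
    by apply: measurable_funC_M => //; exact: measurable_funC_M.
  by apply: measurable_funC_D => //; exact: measurable_funC_D.
apply/seteqP; split => p /=; rewrite /regular unit_tripleE !mulf_eq0 !negb_or;
  by rewrite !andbA.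
Qed.

Lemma measurable_affine_coords : measurable_fun setT (@affine_coords R).
Proof. by case: (@nonsingular_affine_coords R). Qed.

Lemma measurable_alt f : measurable_fun (U4 R) f -> measurable_fun setT (alt f).
Proof.
move=> mf; pose g := f \_ (U4 R).
have mg : measurable_fun setT g by apply: (measurable_restrictT f measurable_U4).1.
pose h p := g (affine_coords p).
have mh : measurable_fun setT h.
  exact: measurableT_comp mg measurable_affine_coords.
pose G p := 6^-1 * (h p + h (rot1 p) + h (rot2 p) - h (swap12 p) - h (swap23 p) - h (swap13 p)).
have mG : measurable_fun setT G.
  have mc (s : V -> V) : nonsingular muV muV s -> measurable_fun setT (fun p => h (s p)).
    by case=> ms _; exact: measurableT_comp mh ms.
  apply: measurable_funM => //.
  apply: measurable_funB; last exact: mc nonsingular_swap13.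
  apply: measurable_funB; last exact: mc nonsingular_swap23.
  apply: measurable_funB; last exact: mc nonsingular_swap12.
  apply: measurable_funD; first apply: measurable_funD => //.
    exact: mc nonsingular_rot1.
  exact: mc nonsingular_rot2.
rewrite (_ : alt f = G \_ [set p | regular p]).
  apply: (measurable_restrictT G measurable_regular).1.
  exact: measurable_funTS.
apply/funext => p; rewrite patchE /alt.
case: ifPn => rp; last by rewrite memNset// => /= rp'; rewrite rp' in rp.
rewrite mem_set//.
have hE q : regular q -> h q = f (affine_coords q).
  by move=> rq; rewrite /h /g patchE mem_set//; exact: U4_affine_coords.
by rewrite /G !hE ?regular_rot1 ?regular_rot2 ?regular_swap12 ?regular_swap23 ?regular_swap13.
Qed.

Lemma alt_ae_bound f (K : R) : alternating_S4 f ->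
  (\forall p \ae @muV R, regular p -> `|alt f p| <= K) <->
  (\forall z \ae lebesgueC2 R, U4 R z -> `|f z| <= K).
Proof.
move=> /alt_ae_eq f_eq; split => h.
  have : \forall p \ae @muV R, regular p -> `|f (affine_coords p)| <= K.
    by apply: filterS2 f_eq h => p pe pK rp; rewrite -pe//; exact: pK.
  move=> /ae_affine -/(_ _)[].
    by move=> k p k0; rewrite -[(_, _, _)]/(scal k p) regular_scal// affine_coords_scal.
  move=> N [mN N0 PN]; exists N; split => // -[x y] /= nK; apply: PN => /= K'.
  apply: nK => Uxy; move: K'; rewrite affine_coordsK; apply.
  move: Uxy; rewrite /regular unit_tripleE /U4 /= oner_eq0 oppr_eq0 !mulf_eq0.
  by rewrite !negb_or.
have := nonsingular_ae (nonsingular_affine_coords : nonsingular _ (lebesgueC2 R) _) h.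
apply: filterS2 f_eq => p pe pK rp; rewrite pe//; apply: pK.
exact: U4_affine_coords.
Qed.

Lemma Linf_norm_bound f (M : R) : measurable_fun (U4 R) f -> alternating_S4 f ->
  (\forall x \ae lebesgueC5 R, U5 R x -> `|Dop f x| <= M) ->
  \forall z \ae lebesgueC2 R, U4 R z -> `|f z| <= 3 * M.
Proof.
move=> mf f_alt /(cocycle_ae_bound f_alt) fM; apply/(alt_ae_bound _ f_alt).
have := essential_bound (measurable_alt mf) (alt_swap12 f) (alt_swap23 f)
  (alt_scal f) fM.
by apply: filterS => p.
Qed.

End alternation_measurable.

(** * The continuous case *)

Section continuity.
Context {R : realType}.
Local Notation C := R[i].
Local Notation V := (C * C * C)%type.
Implicit Types (p q : V).

Lemma nbhs_sqnorm (y : C) (A : set C) : nbhs y A ->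
  exists2 e : R, 0 < e & forall x, sqnorm (x - y) < e -> A x.
Proof.
move=> /nbhs_ballP[e /= e0 eA].
(* Radii of balls are themselves elements of [R[i]]; a positive one has zero imaginary part. *)
case: e e0 eA => e1 e2; rewrite ltcE /= => /andP[/eqP -> e1_gt0] eA.
exists (e1 ^+ 2); first by rewrite exprn_gt0.
move=> x xy; apply: eA; rewrite /ball /= -normrN opprB normc_def ltcE /= eqxx /=.
rewrite -[ltRHS]gtr0_norm// -sqrtr_sqr ltr_sqrt//.
by rewrite exprn_gt0.
Qed.

Lemma within_continuous_U4 (g : C * C -> R) (y : C * C) (e : R) :
  {within U4 R, continuous g} -> U4 R y -> 0 < e ->
  exists2 d : R, 0 < d & forall x, U4 R x -> sqnorm (x.1 - y.1) < d ->
    sqnorm (x.2 - y.2) < d -> `|g x - g y| < e.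
Proof.
move=> /subspace_continuousP gc Uy e0.
have /cvgrPdist_lt/(_ e e0)[[A B] /= [yA yB] AB] := gc y Uy.
have [a a0 aA] := nbhs_sqnorm yA; have [b b0 bB] := nbhs_sqnorm yB.
exists (Num.min a b); first by rewrite lt_min a0.
move=> x Ux; rewrite !lt_min => /andP[x1 _] /andP[_ x2].
rewrite distrC; apply: AB => //; split => /=; [exact: aA|exact: bB].
Qed.

Lemma window_le (r s : R) : r <= s -> window r `<=` window s.
Proof.
move=> rs; have h : near1 r `<=` near1 s.
  move=> [a b] [] /=; rewrite !in_itv /= => /andP[? ?] /andP[? ?].
  by split; rewrite /= in_itv /=; apply/andP; split; lra.
by move=> p [[? ?] ?]; split; [split|]; exact: h.
Qed.

Lemma sqr_le_itv (x r : R) : - r <= x -> x <= r -> x ^+ 2 <= r ^+ 2.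
Proof.
move=> rx xr; rewrite -subr_ge0 subr_sqr mulr_ge0// ?subr_ge0//; lra.
Qed.

Lemma near1_sub1 (r : R) (x : C) : near1 r x -> sqnorm (x - 1) <= 2 * r ^+ 2.
Proof.
case: x => a b [] /=; rewrite !in_itv /= => /andP[a1 a2] /andP[b1 b2].
rewrite /sqnorm /= subr0 mulr_natl mulr2n.
by apply: lerD; apply: sqr_le_itv; lra.
Qed.

Lemma near1_neq0 (x : C) : near1 2^-1 x -> x != 0.
Proof.
move=> /sqnorm_near1/andP[x4 _]; apply/eqP => xE; move: x4.
by rewrite xE /sqnorm /= expr0n /= addr0 leNgt invr_gt0 ltr0n.
Qed.

Lemma near1_ratio (r : R) (x y : C) : r <= 2^-1 -> near1 r x -> near1 r y ->
  sqnorm (x / y - 1) <= 32 * r ^+ 2.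
Proof.
move=> r2 xr yr.
have yr' : near1 2^-1 y.
  by have [[]] := @window_le _ _ r2 (y, y, y) (conj (conj yr yr) yr).
have /andP[y4 _] := sqnorm_near1 yr'.
have y0 := near1_neq0 yr'.
have sy := sqnorm_gt0 y0.
rewrite (_ : x / y - 1 = (x - y) / y); last by rewrite mulrBl divff.
rewrite sqnormM sqnormV// ler_pdivrMr//.
have xy : sqnorm (x - y) <= 8 * r ^+ 2.
  case: x xr => a b [] /=; rewrite !in_itv /= => /andP[a1 a2] /andP[b1 b2].
  case: y {yr' y4 y0 sy} yr => c d [] /=; rewrite !in_itv /= => /andP[c1 c2] /andP[d1 d2].
  rewrite /sqnorm /= (_ : 8 * r ^+ 2 = (2 * r) ^+ 2 + (2 * r) ^+ 2); last by ring.
  by apply: lerD; apply: sqr_le_itv; lra.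
have r0 : 0 <= r ^+ 2 by rewrite sqr_ge0.
by apply: (le_trans xy); nra.
Qed.

Lemma sqnorm_add3 (x y z : C) :
  sqnorm (x + y + z) <= 3 * (sqnorm x + sqnorm y + sqnorm z).
Proof.
case: x y z => a b [c d] [e f]; rewrite /sqnorm /=.
have h (s t u : R) : (s + t + u) ^+ 2 <= 3 * (s ^+ 2 + t ^+ 2 + u ^+ 2).
  have := sqr_ge0 (s - t); have := sqr_ge0 (t - u); have := sqr_ge0 (s - u); nra.
by have := h a c e; have := h b d f; lra.
Qed.

Lemma small_radius (k e : R) : 0 <= k -> 0 < e ->
  exists2 r : R, 0 < r <= 2^-1 & k * r ^+ 2 < e.
Proof.
move=> k0 e0; pose r := Num.min 2^-1 (e / (k + 1)).
have k1 : 0 < k + 1 by lra.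
have ek : 0 < e / (k + 1) by rewrite divr_gt0.
have r0 : 0 < r by rewrite lt_min ek andbT invr_gt0.
have r2 : r <= 2^-1 by rewrite ge_min lexx.
have re : r * (k + 1) <= e by rewrite -ler_pdivlMr// ge_min lexx orbT.
by exists r; [rewrite r0|nra].
Qed.

Lemma regular_window p : regular p -> exists2 r : R, 0 < r <= 2^-1 &
  forall q, window r q -> regular (p * q).
Proof.
move=> /andP[pu s0]; pose S := sqnorm p.1.1 + sqnorm p.1.2 + sqnorm p.2.
have S0 : 0 <= S by apply: addr_ge0; [apply: addr_ge0|]; exact: sqnorm_ge0.
(* The factor 6 is 3 from [sqnorm_add3] times 2 from [near1_sub1]. *)
have [r r0 rs] := small_radius (mulr_ge0 (ltW (ltr0n R 6)) S0) (sqnorm_gt0 s0).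
exists r => // q [[q1 q2] q3]; have /andP[r1 r2] := r0.
have [[q1' q2'] q3'] := @window_le _ _ r2 q (conj (conj q1 q2) q3).
have qu : q \is a GRing.unit by rewrite unit_tripleE !near1_neq0.
rewrite /regular unitrM pu qu /=; apply/eqP => E.
have D : p.1.1 + p.1.2 + p.2 = p.1.1 * (1 - q.1.1) + p.1.2 * (1 - q.1.2) + p.2 * (1 - q.2).
  by rewrite -[LHS]subr0 -E /=; ring.
move: rs; apply/negP; rewrite -leNgt [in leLHS]D.
apply: (le_trans (sqnorm_add3 _ _ _)); rewrite !sqnormM.
have le (x : C) : near1 r x -> sqnorm (1 - x) <= 2 * r ^+ 2.
  by move=> /near1_sub1; rewrite -sqnormN opprB.
have := le _ q1; have := le _ q2; have := le _ q3.
have := sqnorm_ge0 p.1.1; have := sqnorm_ge0 p.1.2; have := sqnorm_ge0 p.2.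
by rewrite /S; nra.
Qed.

(** Multiplicative neighbourhoods suit the faces, which are built from products, and have positive
    measure, so that almost-everywhere inequalities can be evaluated inside them. *)
Definition for_window (P : V -> Prop) :=
  exists2 r : R, 0 < r <= 2^-1 & forall q, window r q -> P q.

Lemma for_windowI (P Q : V -> Prop) :
  for_window P -> for_window Q -> for_window (fun q => P q /\ Q q).
Proof.
move=> [r /andP[r0 r2] rP] [s /andP[s0 s2] sQ]; exists (Num.min r s).
  by rewrite lt_min r0 s0 ge_min r2.
move=> q qm; split; [apply: rP|apply: sQ]; apply: window_le qm;
  by rewrite ge_min lexx ?orbT.
Qed.

Lemma for_window_affine_coords (g : C * C -> R) p (e : R) :
  {within U4 R, continuous g} -> regular p -> 0 < e ->
  for_window (fun q => `|g (affine_coords (p * q)) - g (affine_coords p)| < e).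
Proof.
move=> gc rp e0.
have [d d0 gd] := within_continuous_U4 gc (U4_affine_coords rp) e0.
have [r1 r1_bnd r1P] := regular_window rp.
pose K := sqnorm (p.1.2 / p.1.1) + sqnorm (p.2 / p.1.1).
have K0 : 0 <= K by apply: addr_ge0; exact: sqnorm_ge0.
have [r2 r2_bnd r2P] := small_radius (mulr_ge0 (ltW (ltr0n R 32)) K0) d0.
have [r r_bnd rP] : for_window (fun q => regular (p * q) /\ window r2 q).
  by apply: for_windowI; [exists r1|exists r2].
exists r => // q /rP[rpq [[q1 q2] q3]].
have /andP[pu _] := rp; move: pu; rewrite unit_tripleE => /and3P[a0 b0 c0].
have /andP[_ r22] := r2_bnd.
have yr (x : C) : near1 r2 x -> x != 0.
  move=> xr; apply: near1_neq0.
  by have [[]] := @window_le _ _ r22 (x, x, x) (conj (conj xr xr) xr).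
have key (b x : C) : near1 r2 x -> sqnorm (b / p.1.1) <= K ->
    sqnorm (b * x / (p.1.1 * q.1.1) - b / p.1.1) < d.
  move=> xr bK; have -> : b * x / (p.1.1 * q.1.1) - b / p.1.1 =
      b / p.1.1 * (x / q.1.1 - 1) by field; rewrite a0 yr.
  rewrite sqnormM; apply: le_lt_trans r2P.
  have h := near1_ratio r22 xr q1; have := sqnorm_ge0 (b / p.1.1).
  have := sqnorm_ge0 (x / q.1.1 - 1) => h1 h2.
  apply: (le_trans (ler_pM h2 h1 bK h)).
  by rewrite mulrAC [_ * K]mulrC mulrA.
apply: gd; first exact: U4_affine_coords.
  rewrite /affine_coords /= -opprD sqnormN; apply: key => //.
  by rewrite /K lerDl sqnorm_ge0.
by apply: key => //; rewrite /K lerDr sqnorm_ge0.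
Qed.

Lemma signed_mean6_dist (a b c a' b' c' x y z x' y' z' e : R) :
  `|a - a'| < e -> `|b - b'| < e -> `|c - c'| < e ->
  `|x - x'| < e -> `|y - y'| < e -> `|z - z'| < e ->
  `|6^-1 * (a + b + c - x - y - z) - 6^-1 * (a' + b' + c' - x' - y' - z')| <= e.
Proof.
rewrite !ltr_norml ler_norml => /andP[? ?] /andP[? ?] /andP[? ?] /andP[? ?].
by move=> /andP[? ?] /andP[? ?]; apply/andP; split; lra.
Qed.

Lemma for_window_alt (g : C * C -> R) p (e : R) :
  {within U4 R, continuous g} -> regular p -> 0 < e ->
  for_window (fun q => regular (p * q) /\ `|alt g (p * q) - alt g p| <= e).
Proof.
move=> gc rp e0.
have h (s : V -> V) : regular (s p) -> (forall q, s (p * q) = s p * s q) ->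
    (forall r q, window r q -> window r (s q)) ->
    for_window (fun q => `|g (affine_coords (s (p * q))) - g (affine_coords (s p))| < e).
  move=> rs sM ws; have [r r_bnd rP] := for_window_affine_coords gc rs e0.
  by exists r => // q qr; rewrite sM; apply/rP/ws.
have h0 := for_window_affine_coords gc rp e0.
have h1 : for_window (fun q =>
    `|g (affine_coords (rot1 (p * q))) - g (affine_coords (rot1 p))| < e).
  by apply: h; [rewrite regular_rot1|by []|by move=> r q [[]]].
have h2 : for_window (fun q =>
    `|g (affine_coords (rot2 (p * q))) - g (affine_coords (rot2 p))| < e).
  by apply: h; [rewrite regular_rot2|by []|by move=> r q [[]]].
have h3 : for_window (fun q =>
    `|g (affine_coords (swap12 (p * q))) - g (affine_coords (swap12 p))| < e).
  by apply: h; [rewrite regular_swap12|by []|by move=> r q [[]]].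
have h4 : for_window (fun q =>
    `|g (affine_coords (swap23 (p * q))) - g (affine_coords (swap23 p))| < e).
  by apply: h; [rewrite regular_swap23|by []|by move=> r q [[]]].
have h5 : for_window (fun q =>
    `|g (affine_coords (swap13 (p * q))) - g (affine_coords (swap13 p))| < e).
  by apply: h; [rewrite regular_swap13|by []|by move=> r q [[]]].
have [r r_bnd rP] := for_windowI (for_windowI (regular_window rp) h0)
  (for_windowI (for_windowI h1 h2) (for_windowI h3 (for_windowI h4 h5))).
exists r => // q /rP[[rpq k0] [[k1 k2] [k3 [k4 k5]]]]; split => //.
by rewrite /alt rpq rp; apply: signed_mean6_dist.
Qed.

End continuity.

(** * The pointwise cocycle inequality and the sharp constant *)

Section continuous_representative.
Context {R : realType}.
Local Notation C := R[i].
Local Notation V := (C * C * C)%type.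
Implicit Types (p q d : V) (z : V * V).

Lemma near1_1 (r : R) : 0 < r -> near1 r (1 : C).
Proof. by move=> r0; split; rewrite /= in_itv /=; apply/andP; split; lra. Qed.

Lemma near1M (r : R) (x y : C) : r <= 2^-1 ->
  near1 (r / 4) x -> near1 (r / 4) y -> near1 r (x * y).
Proof.
move=> r2; case: x y => a b [c d] [] /=; rewrite !in_itv /= => /andP[? ?] /andP[? ?].
case=> /=; rewrite !in_itv /= => /andP[? ?] /andP[? ?].
by split; rewrite /= in_itv /=; apply/andP; split; nra.
Qed.

Lemma windowM (r : R) p q : r <= 2^-1 ->
  window (r / 4) p -> window (r / 4) q -> window r (p * q).
Proof.
move=> r2 [[p1 p2] p3] [[q1 q2] q3].
by split; [split|]; exact: near1M.
Qed.

Lemma cocycle_close (a0 a1 a2 a3 a4 b0 b1 b2 b3 b4 M e : R) :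
  `|a0 - b0| <= e / 5 -> `|a1 - b1| <= e / 5 -> `|a2 - b2| <= e / 5 ->
  `|a3 - b3| <= e / 5 -> `|a4 - b4| <= e / 5 ->
  `|a0 - a1 - a2 - a3 - a4| <= M -> `|b0 - b1 - b2 - b3 - b4| <= e + M.
Proof.
rewrite !ler_norml => /andP[? ?] /andP[? ?] /andP[? ?] /andP[? ?] /andP[? ?] /andP[? ?].
by apply/andP; split; lra.
Qed.

Lemma cocycle_average (a b c0 c1 c2 c3 M N e : R) : `|a| <= N ->
  `|b - c0| <= M -> `|c1 - b| <= e / 3 -> `|c2 - c0| <= e / 3 -> `|c3 - c0| <= e / 3 ->
  `|a - b - c1 - c2 - c3| <= M -> 4 * `|b| <= e + (N + 3 * M).
Proof.
rewrite -[4]normr_nat -normrM !ler_norml.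
move=> /andP[? ?] /andP[? ?] /andP[? ?] /andP[? ?] /andP[? ?] /andP[? ?].
by apply/andP; split; lra.
Qed.

Variables (f g : C * C -> R) (M : R).
Hypothesis gc : {within U4 R, continuous g}.
Hypothesis fg : ae_eq (lebesgueC2 R) (U4 R) f g.
Hypothesis fM : \forall z \ae @muV R \xs @muV R, `|cocycle (alt f) z| <= M.

Lemma alt_ae_eq_rep : \forall p \ae @muV R, alt f p = alt g p.
Proof.
have h := nonsingular_ae (nonsingular_affine_coords : nonsingular _ (lebesgueC2 R) _) fg.
have h1 := nonsingular_ae nonsingular_rot1 h.
have h2 := nonsingular_ae nonsingular_rot2 h.
have h3 := nonsingular_ae nonsingular_swap12 h.
have h4 := nonsingular_ae nonsingular_swap23 h.
have h5 := nonsingular_ae nonsingular_swap13 h.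
apply: filterS3 (filterI h h1) (filterI h2 h3) (filterI h4 h5).
move=> p [e0 e1] [e2 e3] [e4 e5]; rewrite /alt; case: ifPn => // rp.
by rewrite e0 ?e1 ?e2 ?e3 ?e4 ?e5//; apply: U4_affine_coords;
  rewrite ?regular_rot1 ?regular_rot2 ?regular_swap12 ?regular_swap23 ?regular_swap13.
Qed.

Lemma cocycle_alt_ae : \forall z \ae @muV R \xs @muV R, `|cocycle (alt g) z| <= M.
Proof.
have h0 := nonsingular_ae nonsingular_face0 alt_ae_eq_rep.
have h1 := nonsingular_ae (nonsingular_fst muV muV) alt_ae_eq_rep.
have h2 := nonsingular_ae nonsingular_mix12 alt_ae_eq_rep.
have h3 := nonsingular_ae nonsingular_face13 alt_ae_eq_rep.
have h4 := nonsingular_ae nonsingular_face23 alt_ae_eq_rep.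
apply: filterS3 (filterI h0 h1) (filterI h2 h3) (filterI h4 fM).
move=> z [e0 e1] [e2 e3] [e4]; rewrite /cocycle.
by rewrite e0 e1 [alt f (face12 z)]e2 e3 e4.
Qed.

(** The almost-everywhere inequality holds at some point arbitrarily close to [z], and continuity of
    [alt g] at the five faces transfers it up to e. *)
Lemma cocycle_alt_regular5 z : regular5 z -> `|cocycle (alt g) z| <= M.
Proof.
case: z => p d [r0 r1 r2 r3 r4].
apply/ler_addgt0Pl => e e0; have e5 : 0 < e / 5 by rewrite divr_gt0.
have w0 := for_window_alt gc r0 e5; have w1 := for_window_alt gc r1 e5.
have w2 := for_window_alt gc r2 e5; have w3 := for_window_alt gc r3 e5.
have w4 := for_window_alt gc r4 e5.
have [r /andP[rpos r12] rP] := for_windowI (for_windowI w0 w1) (for_windowI w2 (for_windowI w3 w4)).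
have r4_gt0 : 0 < r / 4 by rewrite divr_gt0.
have r4r : r / 4 <= r by lra.
have mW := measurable_window (r / 4).
have W0 : (0 < (@muV R \xs muV) (window (r / 4) `*` window (r / 4)))%E.
  rewrite (@product_sfmE _ _ _ _ _ muV muV)//.
  by rewrite mule_gt0// muV_window_gt0.
have pu : p \is a GRing.unit by case/andP: r1.
have du : d \is a GRing.unit.
  move: r2 r3 => /andP[+ _] /andP[+ _]; rewrite !unit_tripleE /=.
  by move=> /and3P[-> -> _] /and3P[_ _]; rewrite mul1r => ->.
have n := nonsingular_pair (nonsingular_mulV pu) (nonsingular_mulV du).
have [z [zp zd] {}n] := ae_exists (measurableX mW mW) W0 (nonsingular_ae n cocycle_alt_ae).
have zp' := window_le r4r zp; have zd' := window_le r4r zd.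
have [_ k0] := (rP _ (windowM r12 zp zd)).1.1.
have [_ k1] := (rP _ zp').1.2.
have m12 : window r (mix12 z) by case: zp' zd' => -[? ?] ? [[? ?] ?].
have m13 : window r (mix13 z) by case: zp' zd' => -[? ?] ? [[? ?] ?].
have m23 : window r (mix23 z) by case: zp' zd' => -[? ?] ? [[? ?] ?].
have [_ k2] := (rP _ m12).2.1.
have [_ k3] := (rP _ m13).2.2.1.
have [_ k4] := (rP _ m23).2.2.2.
have E0 : face0 (p * z.1, d * z.2) = face0 (p, d) * (z.1 * z.2).
  by rewrite -[RHS]mulrA; congr (neg23 * _); exact: mulrACA.
have E2 : face12 (p * z.1, d * z.2) = face12 (p, d) * mix12 z by [].
have E3 : face13 (p * z.1, d * z.2) = face13 (p, d) * mix13 z.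
  by rewrite /face13 -mulrA.
have E4 : face23 (p * z.1, d * z.2) = face23 (p, d) * mix23 z.
  by rewrite /face23 -mulrA.
have n' : `|alt g (face0 (p, d) * (z.1 * z.2)) - alt g (p * z.1)
    - alt g (face12 (p, d) * mix12 z) - alt g (face13 (p, d) * mix13 z)
    - alt g (face23 (p, d) * mix23 z)| <= M.
  by rewrite -E0 -E2 -E3 -E4; exact: n.
exact: (cocycle_close k0 k1 k2 k3 k4 n').
Qed.

(* The two simplices share all faces but two, which cancel by alternation. *)
Lemma alt_neg2_le q : regular q -> regular (neg2 * q) ->
  `|alt g q - alt g (neg2 * q)| <= M.
Proof.
case: q => -[X Y] Z rq rnq.
have [X0 Y0 Z0 _] := regularP rq.
have e12 (i j k : C) : alt g (j, i, k) = - alt g (i, j, k) by exact: alt_swap12 g (i, j, k).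
have e23 (i j k : C) : alt g (i, k, j) = - alt g (i, j, k) by exact: alt_swap23 g (i, j, k).
have e13 (i j k : C) : alt g (k, j, i) = - alt g (i, j, k) by exact: alt_swap13 g (i, j, k).
have face (s : C) : s != 0 -> s + s + Z != 0 -> X - s - s != 0 ->
    `|alt g (neg2 * (X, Y, Z)) - alt g (X, Y, Z) - alt g (s, - Y, - s)| <= M.
  move=> s0 sZ sX.
  have := @cocycle_alt_regular5 ((X, Y, Z), (s, s, - s)).
  rewrite cocycleE /regular5 /face0 /face12 /face13 /face23 /neg2 /neg23.
  rewrite /mix12 /mix13 /mix23 /= !mul_tripleE !mul1r !mulN1r => h.
  (* The degenerate direction d = (s, s, -s), available now that the inequality holds pointwise,
     gives two faces a repeated entry, where alternation forces the value 0. *)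
  have z1 : alt g (s, s, Z) = 0 by have := e12 s s Z; lra.
  have z2 : alt g (X, - s, - s) = 0 by have := e23 X (- s) (- s); lra.
  move: h; rewrite z1 z2 !subr0.
  have -> : (X * s, - (Y * s), - (Z * - s)) = scal s (X, - Y, Z).
    by rewrite /scal /= mulrN opprK -mulNr ![s * _]mulrC.
  rewrite alt_scal// regular_scal//; apply.
  move: rnq; rewrite /neg2 mul_tripleE !mul1r mulN1r => rnq.
  split => //.
  - by rewrite /regular unit_tripleE /= s0 Z0.
  - by rewrite /regular unit_tripleE /= !oppr_eq0 s0 Y0 addrAC subrr add0r oppr_eq0.
  - by rewrite /regular unit_tripleE /= !oppr_eq0 s0 X0.
(* A real number so large that both s = m and s = -m satisfy the nonvanishing conditions of
   [face]. *)
pose r : R := 1 + sqnorm X + sqnorm Z.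
have r1 : 1 <= r by rewrite /r; have := sqnorm_ge0 X; have := sqnorm_ge0 Z; lra.
pose m : C := (r +i* 0)%C.
have m0 : m != 0 by rewrite eq_complex /= negb_and gt_eqF//; lra.
have key (W : C) : sqnorm W <= r -> m + m + W != 0.
  move=> Wr; apply/eqP => /eqP; rewrite addr_eq0 => /eqP E.
  have := sqnormN W; rewrite -E /sqnorm /= -/(sqnorm W) addr0 expr0n addr0.
  by move: Wr; nra.
have Xr : sqnorm X <= r by rewrite /r; have := sqnorm_ge0 Z; lra.
have Zr : sqnorm Z <= r by rewrite /r; have := sqnorm_ge0 X; lra.
have h1 : `|alt g (neg2 * (X, Y, Z)) - alt g (X, Y, Z) - alt g (m, - Y, - m)| <= M.
  apply: face => //; first exact: key.
  rewrite -oppr_eq0 !opprB addrA; apply: key; by rewrite sqnormN.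
(* For s = -m the remaining face is the opposite of the one for s = m, so the mean of the two
   inequalities eliminates it. *)
have h2 : `|alt g (neg2 * (X, Y, Z)) - alt g (X, Y, Z) + alt g (m, - Y, - m)| <= M.
  have := face (- m); rewrite !opprK (e13 m) opprK oppr_eq0; apply => //.
  - by rewrite -oppr_eq0 !opprD !opprK; apply: key; rewrite sqnormN.
  - by rewrite -addrA addrC; apply: key.
move: h1 h2; clear; rewrite !ler_norml => /andP[? ?] /andP[? ?].
by apply/andP; split; lra.
Qed.

(** For d near 1, the four faces of (q, q . d) other than the product one are near q, q and twice
    near [neg2 * q]. Replacing the latter two by q costs 2 M in all by [alt_neg2_le]; the bound 2 M
    of [ae_neg2] would cost 4 M and miss the constant 1. *)
Lemma alt_contraction (N : R) q : (\forall p \ae @muV R, `|alt g p| <= N) ->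
  regular q -> regular (neg2 * q) -> 4 * `|alt g q| <= N + 3 * M.
Proof.
move=> gN rq rnq.
apply/ler_addgt0Pl => e e0; have e3 : 0 < e / 3 by rewrite divr_gt0.
have [r /andP[r0 r2] rP] := for_windowI (for_window_alt gc rq e3) (for_window_alt gc rnq e3).
have qu : q \is a GRing.unit by case/andP: rq.
have ku : neg23 * (q * q) \is a GRing.unit by rewrite !unitrM unit_neg23 qu.
have n := nonsingular_mulV ku.
have [d dr [dN dreg]] := ae_exists (measurable_window r) (muV_window_gt0 r0)
  (filterI (nonsingular_ae n gN) (nonsingular_ae n (@ae_regular R))).
have E0 : face0 (q, q * d) = neg23 * (q * q) * d by rewrite /face0 /= -!mulrA.
have E12 : face12 (q, q * d) = q * mix12 (1, d).
  by rewrite /face12 /mix12; case: (q) (d) => -[? ?] ? [[? ?] ?]; rewrite !mul_tripleE mulr1.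
have E13 : face13 (q, q * d) = neg2 * q * mix13 (1, d).
  rewrite /face13 -mulrA; congr (neg2 * _); rewrite /mix13.
  by case: (q) (d) => -[? ?] ? [[? ?] ?]; rewrite !mul_tripleE mulr1.
have E23 : face23 (q, q * d) = neg2 * q * mix23 (1, d).
  rewrite /face23 -mulrA; congr (neg2 * _); rewrite /mix23.
  by case: (q) (d) => -[? ?] ? [[? ?] ?]; rewrite !mul_tripleE mulr1.
have w1 := near1_1 r0.
have m12 : window r (mix12 (1, d)) by case: dr => -[? ?] ?.
have m13 : window r (mix13 (1, d)) by case: dr => -[? ?] ?.
have m23 : window r (mix23 (1, d)) by case: dr => -[? ?] ?.
have [[r12 k12] _] := rP _ m12.
have [_ [r13 k13]] := rP _ m13.
have [_ [r23 k23]] := rP _ m23.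
have := @cocycle_alt_regular5 (q, q * d).
rewrite /regular5 /cocycle E0 E12 E13 E23 => /(_ (And5 dreg rq r12 r13 r23)).
exact: (cocycle_average dN (alt_neg2_le rq rnq) k12 k13 k23).
Qed.

Lemma alt_ae_contraction (N : R) : (\forall p \ae @muV R, regular p -> `|alt f p| <= N) ->
  \forall p \ae @muV R, regular p -> `|alt f p| <= (N + 3 * M) / 4.
Proof.
move=> fN.
have gN : \forall p \ae @muV R, `|alt g p| <= N.
  by apply: filterS3 alt_ae_eq_rep fN (@ae_regular R) => p -> pN /pN.
have rn := nonsingular_ae (nonsingular_mulV unit_neg2) (@ae_regular R).
apply: filterS2 alt_ae_eq_rep rn => p -> rnp rp.
by rewrite ler_pdivlMr// mulrC; exact: alt_contraction.
Qed.

End continuous_representative.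

Theorem theorem3p1 (R : realType) (f : R[i] * R[i] -> R)
    (f_L0 : L0 (U4 R) f)
    (f_alt : alternating_S4 f)
    (Df_Linf : Linf (lebesgueC5 R) (U5 R) (Dop f)) :
  (Linf_norm (lebesgueC2 R) (U4 R) f
     <= 7%:E * Linf_norm (lebesgueC5 R) (U5 R) (Dop f))%E /\
  (has_continuous_rep f ->
   (Linf_norm (lebesgueC2 R) (U4 R) f
     <= Linf_norm (lebesgueC5 R) (U5 R) (Dop f))%E).
Proof.
have avg (a b : R) : a <= (a + 3 * b) / 4 -> a <= b by lra.
case: Df_Linf => _ Df_lty.
have Df_ge0 : (0 <= Linf_norm (lebesgueC5 R) (U5 R) (Dop f))%E by exact: Lnorm_ge0.
have Df_fin : Linf_norm (lebesgueC5 R) (U5 R) (Dop f) \is a fin_num.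
  by rewrite ge0_fin_numE.
move: Df_ge0; rewrite -(fineK Df_fin) lee_fin; set M := fine _ => M0.
have DfM : \forall x \ae lebesgueC5 R, U5 R x -> `|Dop f x| <= M.
  by apply/(Linf_norm_leP _ _ _ M0); rewrite /M fineK.
have f3M : (Linf_norm (lebesgueC2 R) (U4 R) f <= (3 * M)%:E)%E.
  by apply/Linf_norm_leP; [rewrite mulr_ge0|exact: Linf_norm_bound].
split.
  by apply: (le_trans f3M); rewrite -EFinM lee_fin ler_wpM2r// ler_nat.
case=> g [gc fg].
have f_ge0 : (0 <= Linf_norm (lebesgueC2 R) (U4 R) f)%E by exact: Lnorm_ge0.
(* Finiteness of the norm, known from the bound 3 M, is indispensable: N <= (N + 3 M) / 4 gives no
   information for an infinite N. *)
have f_fin : Linf_norm (lebesgueC2 R) (U4 R) f \is a fin_num.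
  by rewrite ge0_fin_numE// (le_lt_trans f3M) ?ltry.
move: f_ge0; rewrite -(fineK f_fin) !lee_fin; set N := fine _ => N0.
have fN : \forall x \ae lebesgueC2 R, U4 R x -> `|f x| <= N.
  by apply/(Linf_norm_leP _ _ _ N0); rewrite /N fineK.
move/(alt_ae_bound _ f_alt): fN.
move=> /(alt_ae_contraction gc fg (cocycle_ae_bound f_alt DfM)).
move=> /(alt_ae_bound _ f_alt) => fN.
have : (N%:E <= ((N + 3 * M) / 4)%:E)%E.
  rewrite {1}/N fineK//; apply/Linf_norm_leP => //.
  by rewrite divr_ge0// addr_ge0// mulr_ge0.
by rewrite lee_fin => /avg.
Qed.
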